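(* Let $\mathfrak{g}$ be an affine Kac--Moody algebra of dual untwisted type having a special node (i.e. $\mathfrak{g}$ of simply-laced affine type, $A_{2n-1}^{(2)}$, or $D_{n+1}^{(2)}$), and let $r \in I_0$ be a special node, so that $\Lambda_r$ is a minuscule weight of $\mathfrak{g}_0$. Let $u = u_{\Lambda_r}$ be the maximal element of the Kirillov--Reshetikhin crystal $B^{r,1}$. Then for every classically highest weight element $b \otimes u \in B^{r,1} \otimes B^{r,1}$, the local energy $H(b \otimes u)$ equals the number of $r$-arrows in a path from $b$ to $u$ in the crystal graph of $B(\Lambda_r)$ (i.e. the number of $r$-arrows in a path $u \to \cdots \to b$ of arrows $f_a$, $a \in I_0$).
   Context: $\mathfrak{g}$ has index set $I=\{0,1,\dots,n\}$ (Kac labeling), $I_0 = I\setminus\{0\}$, and $\mathfrak{g}_0$ is the simple Lie algebra with index set $I_0$. A node $r\in I_0$ is special if some automorphism of the affine Dynkin diagram sends $0$ to $r$. $B^{r,1}$ is the Kirillov--Reshetikhin $U_q'(\mathfrak{g})$-crystal; for special $r$ it is isomorphic to $B(\Lambda_r)$ as a $U_q(\mathfrak{g}_0)$-crystal, and $u_{\Lambda_r}$ is its unique element of classical weight $\Lambda_r$. Tensor product convention (opposite to Kashiwara's): for $b_2\otimes b_1$, $e_a(b_2\otimes b_1)=e_ab_2\otimes b_1$ if $\varepsilon_a(b_2)>\varphi_a(b_1)$ and $b_2\otimes e_ab_1$ otherwise; $f_a(b_2\otimes b_1)=f_ab_2\otimes b_1$ if $\varepsilon_a(b_2)\ge\varphi_a(b_1)$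 and $b_2\otimes f_ab_1$ otherwise. An element is classically highest weight if $e_a$ kills it for all $a\in I_0$. The local energy $H\colon B^{r,1}\otimes B^{r,1}\to\mathbb{Z}$ is determined by: $H(e_i(b\otimes b')) = H(b\otimes b') -1$ if $i=0$ and $e_0$ acts on the left factor, $+1$ if $i=0$ and $e_0$ acts on the right factor, and $+0$ if $i\neq 0$ (whenever $e_i(b\otimes b')\neq 0$), normalized by $H(u\otimes u)=0$. (Here the combinatorial $R$-matrix $B^{r,1}\otimes B^{r,1}\to B^{r,1}\otimes B^{r,1}$ is the identity.)
   Formalization: The sign of the local energy H is reversed: H changes by +1 when e_0 acts on the left factor and by -1 when it acts on the right; with the printed signs H(b⊗u) would be minus the number of r-arrows (already for A_1^(1), r=1). *)

(* Defs.v *)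
From mathcomp Require Import all_boot all_order all_fingroup all_algebra.

Set Implicit Arguments.
Unset Strict Implicit.
Unset Printing Implicit Defensive.

Import Order.TTheory GRing.Theory Num.Theory.
Local Open Scope ring_scope.

(** * Affine types *)

(* TypeA n, TypeD n, TypeE6, TypeE7, TypeE8 stand for the simply-laced types
   A_n^(1), D_n^(1), E_6^(1), E_7^(1), E_8^(1); TypeA2odd n stands for
   A_{2n-1}^(2) and TypeD2 n for D_{n+1}^(2).  All have nodes 0, ..., rank,
   labelled as in Kac's tables. *)
Inductive affine_type :=
  | TypeA of nat | TypeD of nat | TypeE6 | TypeE7 | TypeE8
  | TypeA2odd of nat | TypeD2 of nat.

Definition rank (t : affine_type) : nat :=
  match t with
  | TypeA n | TypeD n | TypeA2odd n | TypeD2 n => n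
  | TypeE6 => 6 | TypeE7 => 7 | TypeE8 => 8
  end.

Definition valid_type (t : affine_type) : bool :=
  match t with
  | TypeA n => (1 <= n)%N
  | TypeD n => (4 <= n)%N
  | TypeA2odd n => (3 <= n)%N
  | TypeD2 n => (2 <= n)%N
  | _ => true
  end.

Notation node t := 'I_(rank t).+1.

(* The chain a - a+1 - ... - b. *)
Definition chain (a b : nat) : seq (nat * nat) :=
  [seq (k, k.+1) | k <- iota a (b - a)].

Definition edges (t : affine_type) : seq (nat * nat) :=
  match t with
  | TypeA n => (0, n)%N :: chain 0 n
  | TypeD n => [:: (0, 2); (n - 2, n)]%N ++ chain 1 (n - 1)
  | TypeE6 => [:: (3, 6); (6, 0)]%N ++ chain 1 5
  | TypeE7 => (3, 7)%N :: chain 0 6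
  | TypeE8 => (5, 8)%N :: chain 0 7
  | TypeA2odd n => (0, 2)%N :: chain 1 n
  | TypeD2 n => chain 0 n
  end.

(* cartan t i j = <h_i, alpha_j>. *)
Definition cartan (t : affine_type) (i j : nat) : int :=
  if i == j then 2
  else if ((i, j) \in edges t) || ((j, i) \in edges t) then
    match t with
    | TypeA n => if n == 1%N then -2 else -1
    | TypeA2odd n => if (i == n.-1) && (j == n) then -2 else -1
    | TypeD2 n => if ((i == 0) && (j == 1) || (i == n) && (j == n.-1))%N
                  then -2 else -1
    | _ => -1
    end
  else 0.

(* (alpha_i, alpha_i) / 2, normalized to coprime integers: this symmetrizes
   the Cartan matrix, symm t i * cartan t i j = symm t j * cartan t j i. *)
Definition symm (t : affine_type) (i : nat) : nat :=
  match t with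
  | TypeA2odd n => if i == n then 2 else 1
  | TypeD2 n => if (i == 0)%N || (i == n) then 1 else 2
  | _ => 1
  end.

(* The dual Kac labels a_i^vee: the canonical central element is
   \sum_i comark t i * h_i, i.e. \sum_i comark t i * cartan t i j = 0. *)
Definition comark (t : affine_type) (i : nat) : nat :=
  match t with
  | TypeA _ => 1
  | TypeD n => if i \in [:: 0; 1; n - 1; n]%N then 1 else 2
  | TypeE6 => nth 0 [:: 1; 1; 2; 3; 2; 1; 2] i
  | TypeE7 => nth 0 [:: 1; 2; 3; 4; 3; 2; 1; 2] i
  | TypeE8 => nth 0 [:: 1; 2; 3; 4; 5; 6; 4; 2; 3] i
  | TypeA2odd n => if (i <= 1)%N then 1 else 2
  | TypeD2 n => if (i == 0)%N || (i == n) then 1 else 2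
  end%N.

Definition special (t : affine_type) (r : node t) : Prop :=
  exists s : {perm (node t)},
    (forall i j, cartan t (s i) (s j) = cartan t i j) /\ s ord0 = r.

(** * Weights *)

(* The weight lattice of U_q'(g) is P / (P :&: Q delta) = \bigoplus_i Z Lambda_i;
   a weight is given by its values on the simple coroots. *)
Notation weight t := {ffun node t -> int}.

Definition alpha (t : affine_type) (i : node t) : weight t :=
  [ffun j : node t => cartan t j i].

Definition Lambda (t : affine_type) (i : node t) : weight t :=
  [ffun j : node t => (j == i)%:Z].

(* The level-zero fundamental weight Lambda_r - a_r^vee Lambda_0. *)
Definition varpi (t : affine_type) (r : node t) : weight t :=
  Lambda r - Lambda ord0 *+ comark t r.

(** * Modules over the quantum affine algebra U_q'(g) *)

Definition Qq : fieldType := {fraction {poly rat}}.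

Definition q : Qq := tofrac 'X.

Definition qcst (c : rat) : Qq := tofrac c%:P.

Definition q_ (t : affine_type) (i : node t) : Qq := q ^+ symm t i.

Definition qint (t : affine_type) (i : node t) (k : nat) : Qq :=
  (q_ i ^+ k - q_ i ^- k) / (q_ i - (q_ i)^-1).

Definition qfact (t : affine_type) (i : node t) (k : nat) : Qq :=
  \prod_(1 <= s < k.+1) qint i s.

(* Action of the Chevalley generators e_i, f_i, K_i and K_i^{-1}. *)
Record Uq_action (t : affine_type) (V : vectType Qq) := UqAction {
  actE : node t -> 'End(V);
  actF : node t -> 'End(V);
  actK : node t -> 'End(V);
  actKinv : node t -> 'End(V)
}.

(* The divided power X_i^(k) = X_i^k / [k]_i! *)
Definition divpow (t : affine_type) (V : vectType Qq)
    (X : node t -> 'End(V)) (i : node t) (k : nat) (v : V) : V :=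
  (qfact i k)^-1 *: iter k (X i) v.

Definition qSerre (t : affine_type) (V : vectType Qq)
    (X : node t -> 'End(V)) : Prop :=
  forall i j : node t, i != j -> forall v : V,
    let m := `|1 - cartan t i j|%N in
    \sum_(s < m.+1)
      (-1) ^+ s *: divpow X i s (X j (divpow X i (m - s) v)) = 0.

Record Uq_module (t : affine_type) (V : vectType Qq) (M : Uq_action t V) :
    Prop := {
  Uq_KinvK : forall i v, actKinv M i (actK M i v) = v;
  Uq_KKinv : forall i v, actK M i (actKinv M i v) = v;
  Uq_KK : forall i j v, actK M i (actK M j v) = actK M j (actK M i v);
  Uq_KE : forall i j v,
    actK M i (actE M j v) = q_ i ^ cartan t i j *: actE M j (actK M i v);
  Uq_KF : forall i j v,
    actK M i (actF M j v) = q_ i ^ (- cartan t i j) *: actF M j (actK M i v);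
  Uq_EF : forall i j v,
    actE M i (actF M j v) - actF M j (actE M i v) =
      if i == j then (q_ i - (q_ i)^-1)^-1 *: (actK M i v - actKinv M i v)
      else 0;
  Uq_serreE : qSerre (actE M);
  Uq_serreF : qSerre (actF M)
}.

Definition in_wt (t : affine_type) (V : vectType Qq) (M : Uq_action t V)
    (lam : weight t) (v : V) : Prop :=
  forall i, actK M i v = q_ i ^ (lam i) *: v.

Definition weight_module (t : affine_type) (V : vectType Qq)
    (M : Uq_action t V) : Prop :=
  forall v : V, exists s : seq (weight t * V),
    (forall x, x \in s -> in_wt M x.1 x.2) /\ v = \sum_(x <- s) x.2.

Definition irreducible_module (t : affine_type) (V : vectType Qq)
    (M : Uq_action t V) : Prop :=
  forall U : {vspace V},
    (forall i, [/\ (actE M i @: U <= U)%VS, (actF M i @: U <= U)%VS,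
                   (actK M i @: U <= U)%VS & (actKinv M i @: U <= U)%VS]) ->
    U = 0%VS \/ U = fullv.

(* The maximal weight of V is lam, with one-dimensional weight space. *)
Definition has_highest_weight (t : affine_type) (V : vectType Qq)
    (M : Uq_action t V) (lam : weight t) : Prop :=
  (exists2 v0 : V, v0 != 0 /\ in_wt M lam v0 &
     forall v, in_wt M lam v -> exists c, v = c *: v0) /\
  (forall mu v, in_wt M mu v -> v != 0 ->
     exists c : node t -> nat,
       lam - mu = \sum_(i | i != ord0) alpha i *+ c i).

(* W^{r,1}: by the Chari-Pressley classification, the irreducible
   finite-dimensional modules (of type 1) with highest weight varpi_r are those
   whose Drinfeld polynomials are P_r(z) = 1 - c z for some c, and P_j(z) = 1
   for j != r.  They differ only by the spectral parameter c. *)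
Definition KR_module (t : affine_type) (r : node t) (V : vectType Qq)
    (M : Uq_action t V) : Prop :=
  [/\ Uq_module M, weight_module M, irreducible_module M
    & has_highest_weight M (varpi r)].

(** * Crystals and crystal bases *)

(* None plays the role of the extra element 0. *)
Record crystal (t : affine_type) := Crystal {
  crystal_car :> finType;
  ce : node t -> crystal_car -> option crystal_car;
  cf : node t -> crystal_car -> option crystal_car;
  cwt : crystal_car -> weight t
}.
Arguments ce {t B} i b : rename.
Arguments cf {t B} i b : rename.
Arguments cwt {t B} b : rename.

Definition eps (t : affine_type) (B : crystal t) (i : node t) (b : B) : nat :=
  \max_(k < #|B|.+1 | isSome (iter k (obind (ce i)) (Some b))) k.

Definition phi (t : affine_type) (B : crystal t) (i : node t) (b : B) : nat :=
  \max_(k < #|B|.+1 | isSome (iter k (obind (cf i)) (Some b))) k.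

(* The string decomposition v = \sum_k f_i^(k) x_k of a vector v of weight
   lam, where e_i x_k = 0 and k runs over k >= max(0, - <h_i, lam>). *)
Definition string_dec (t : affine_type) (V : vectType Qq) (M : Uq_action t V)
    (i : node t) (lam : weight t) (v : V) (N : nat) (x : nat -> V) : Prop :=
  [/\ forall k, in_wt M (lam + alpha i *+ k) (x k),
      forall k, actE M i (x k) = 0,
      forall k : nat, k%:Z + lam i < 0 -> x k = 0
    & v = \sum_(0 <= k < N) divpow (actF M) i k (x k)].

(* Kashiwara's modified root operators on vectors of weight lam:
   kash_e M i lam v w says that w is the image of v, likewise for kash_f. *)
Definition kash_e (t : affine_type) (V : vectType Qq) (M : Uq_action t V)
    (i : node t) (lam : weight t) (v w : V) : Prop :=
  exists N x, string_dec M i lam v N x /\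
    w = \sum_(1 <= k < N) divpow (actF M) i k.-1 (x k).

Definition kash_f (t : affine_type) (V : vectType Qq) (M : Uq_action t V)
    (i : node t) (lam : weight t) (v w : V) : Prop :=
  exists N x, string_dec M i lam v N x /\
    w = \sum_(0 <= k < N) divpow (actF M) i k.+1 (x k).

(* The local ring of the rational functions in q that are regular at q = 0. *)
Definition regular0 (x : Qq) : Prop :=
  exists n d : {poly rat}, d.[0] != 0 /\ x = tofrac n / tofrac d.

Definition crystal_lattice (t : affine_type) (V : vectType Qq)
    (M : Uq_action t V) (L : V -> Prop) : Prop :=
  [/\ exists2 X : (\dim {:V}).-tuple V, basis_of {:V} X &
        forall v, L v <-> forall i, regular0 (coord X i v),
      forall v, L v -> exists s : seq (weight t * V),
        (forall x, x \in s -> in_wt M x.1 x.2 /\ L x.2) /\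
        v = \sum_(x <- s) x.2
    & forall i lam v w, in_wt M lam v -> L v ->
        (kash_e M i lam v w -> L w) /\ (kash_f M i lam v w -> L w)].

(* Equality in L / q L. *)
Definition eq_modq (V : vectType Qq) (L : V -> Prop) (v w : V) : Prop :=
  L (q^-1 *: (v - w)).

(* (L, B) is a crystal basis of V; the element b of the basis B of L / q L is
   given by a weight vector rep b of L which lifts it. *)
Definition crystal_basis (t : affine_type) (V : vectType Qq)
    (M : Uq_action t V) (L : V -> Prop) (B : crystal t) (rep : B -> V) :
    Prop :=
  [/\ crystal_lattice M L,
      forall b, L (rep b) /\ in_wt M (cwt b) (rep b),
      forall v, L v -> exists! c : {ffun B -> rat},
        eq_modq L v (\sum_b qcst (c b) *: rep b),
      forall (i : node t) (b : B) (w : V),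
        (kash_e M i (cwt b) (rep b) w ->
           eq_modq L w (if ce i b is Some b' then rep b' else 0)) /\
        (kash_f M i (cwt b) (rep b) w ->
           eq_modq L w (if cf i b is Some b' then rep b' else 0))
    & forall (i : node t) (b b' : B), cf i b = Some b' <-> ce i b' = Some b].

(* B is (a copy of) the Kirillov-Reshetikhin crystal B^{r,1}. *)
Definition KR_crystal (t : affine_type) (r : node t) (B : crystal t) : Prop :=
  exists (V : vectType Qq) (M : Uq_action t V) (L : V -> Prop) (rep : B -> V),
    KR_module r M /\ crystal_basis M L rep.

Definition classical_weight (t : affine_type) (r : node t) (B : crystal t)
    (b : B) : Prop :=
  forall i : node t, i != ord0 -> cwt b i = Lambda r i.

(* p is the sequence of labels of a path b -> ... -> b' of classical arrows. *)
Definition classical_path (t : affine_type) (B : crystal t) (b b' : B)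
    (p : seq (node t)) : Prop :=
  ord0 \notin p /\ foldl (fun ob a => obind (cf a) ob) (Some b) p = Some b'.

(** * Tensor square and local energy *)

(* In the tensor square, x = (b2, b1) stands for b2 (x) b1, with the convention
   opposite to Kashiwara's. *)
Definition e_left (t : affine_type) (B : crystal t) (i : node t) (x : B * B) :
    bool :=
  (phi i x.2 < eps i x.1)%N.

Definition tensor_e (t : affine_type) (B : crystal t) (i : node t)
    (x : B * B) : option (B * B) :=
  if e_left i x then omap (fun b => (b, x.2)) (ce i x.1)
  else omap (fun b => (x.1, b)) (ce i x.2).

Definition classically_highest (t : affine_type) (B : crystal t)
    (x : B * B) : Prop :=
  forall a : node t, a != ord0 -> tensor_e a x = None.

(* The local energy (the combinatorial R-matrix being the identity).  The sign
   is the one for which H is the nonnegative energy, matching cocharge: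
   e_0 (u (x) u) = e_0 u (x) u has energy 1.  The convention with -1 on the
   left and +1 on the right defines - H. *)
Definition local_energy (t : affine_type) (B : crystal t) (u : B)
    (H : B * B -> int) : Prop :=
  H (u, u) = 0 /\
  forall (i : node t) (x y : B * B), tensor_e i x = Some y ->
    H y = H x + (if i == ord0 then (if e_left i x then 1 else -1) else 0).

(* Main.v *)
Require Import Defs.
From mathcomp Require Import all_boot all_order all_fingroup all_algebra.
From mathcomp Require Import zify ring.

Set Implicit Arguments.
Unset Strict Implicit.
Unset Printing Implicit Defensive.

Import Order.TTheory GRing.Theory Num.Theory.
Import Defs.
Local Open Scope ring_scope.

(* Every weight mu of V satisfies (mu, mu) = (varpi_r, varpi_r) and
   |<h_i, mu>| <= 1: apply simple reflections in I_0 until mu is I_0-dominant;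
   its value at h_0 is then at least -1, and as fundamental weights with
   comark 1 are pairwise incongruent modulo Q, mu = varpi_r.  By the same
   congruence argument varpi_r is the only weight that is <= 0 at all h_i with
   i != r.  Consequently the strings of the crystal have length at most one,
   and every b is joined to u by arrows f_a with a != r (a = 0 allowed).  Since
   phi_a u = 0 for these a, e_a acts on the left factor of b (x) u, so
   H (b (x) u) is the number of 0-arrows of that path.  Followed after a
   classical path from u to b it closes up, hence the total number of arrows
   of each colour is proportional to the coefficients of delta, in which 0 and
   r have the same coefficient; so the 0-arrows of the second path are as many
   as the r-arrows of the first. *)

(** * Affine Cartan matrices *)

Lemma mem_chain a b i j :
  ((i, j) \in chain a b) = [&& (a <= i)%N, (i < b)%N & (j == i.+1)].
Proof.
apply/mapP/idP => [[k + [-> ->]]|/and3P[ai ib /eqP->]].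
  by rewrite mem_iota; lia.
by exists i => //; rewrite mem_iota; lia.
Qed.

(** An arithmetic form of membership in [edges], so that [lia] decides adjacency for generic
    rank. *)
Definition edge (t : affine_type) (i j : nat) : bool :=
  match t with
  | TypeA n => ((i == 0) && (j == n)) || ((i < n) && (j == i.+1))
  | TypeD n => [|| (i == 0) && (j == 2), (i == n - 2) && (j == n)
                 | [&& 1 <= i, i < n - 1 & j == i.+1]]
  | TypeE6 => [|| (i == 3) && (j == 6), (i == 6) && (j == 0)
                 | [&& 1 <= i, i < 5 & j == i.+1]]
  | TypeE7 => (i == 3) && (j == 7) || (i < 6) && (j == i.+1)
  | TypeE8 => (i == 5) && (j == 8) || (i < 7) && (j == i.+1)
  | TypeA2odd n => (i == 0) && (j == 2) || [&& 1 <= i, i < n & j == i.+1]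
  | TypeD2 n => (i < n) && (j == i.+1)
  end%N.

Lemma mem_edges t i j : ((i, j) \in edges t) = edge t i j.
Proof.
by case: t => [n|n||||n|n]; apply/idP/idP;
  rewrite /edges /edge ?(mem_cat, in_cons, in_nil, mem_chain, xpair_eqE); lia.
Qed.

Lemma cartanii t i : cartan t i i = 2.
Proof. by rewrite /cartan eqxx. Qed.

Lemma cartan_le0 t i j : i != j -> cartan t i j <= 0.
Proof.
rewrite /cartan => /negbTE ->; case: ifP => // _.
by case: t => [n|n||||n|n] //; case: ifP.
Qed.

Lemma cartan_edge_neq0 t i j : i != j -> edge t j i || edge t i j ->
  cartan t i j != 0.
Proof.
rewrite /cartan !mem_edges orbC => /negbTE-> ->.
by case: t => [n|n||||n|n] //=; case: ifP.
Qed.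

Lemma symm_gt0 t i : (0 < symm t i)%N.
Proof. by case: t => //= n; case: ifP. Qed.

Lemma symm_cartan t i j : valid_type t -> (i <= rank t)%N -> (j <= rank t)%N ->
  (symm t i)%:Z * cartan t i j = (symm t j)%:Z * cartan t j i.
Proof.
rewrite /cartan !mem_edges orbC (eq_sym j i).
case: eqP => [-> //|ne]; case: ifP => //; case: t => [n|n||||n|n] //=.
all: by do ?case: ifP; lia.
Qed.

Lemma symm0 t : valid_type t -> symm t 0 = 1%N.
Proof. by case: t => //= [[|n]]. Qed.

Lemma comark0 t : comark t 0 = 1%N.
Proof. by case: t => //= n. Qed.

Lemma comark_gt0 t i : (i <= rank t)%N -> (0 < comark t i)%N.
Proof.
by case: t => [n|n||||n|n] //=; try (case: ifP => //);
  do ?[case: i => [|i] //=].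
Qed.

Lemma symm_comark1 t i : valid_type t -> (i <= rank t)%N ->
  comark t i = 1%N -> symm t i = 1%N.
Proof.
by case: t => [n|n||||n|n] //=; do ?case: ifP; lia.
Qed.

(** An induction principle along the diagram. Each diagram is spanned by one chain and at most two
    further edges; pieces that share a node are joined by [glue]. *)
Lemma diagram_connected t (P : nat -> Prop) i0 j : valid_type t ->
  (i0 <= rank t)%N -> (j <= rank t)%N -> P i0 ->
  (forall i k, (i <= rank t)%N -> (k <= rank t)%N ->
     edge t i k || edge t k i -> P i -> P k) ->
  P j.
Proof.
move=> tv i0t jt Pi0 step.
have chainP a b : (forall k, a <= k -> k < b -> edge t k k.+1)%N ->
    (b <= rank t)%N -> forall i k, (a <= i)%N -> (i <= b)%N ->
    (a <= k)%N -> (k <= b)%N -> P i -> P k.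
  move=> ab bt i k ai ib.
  have up m : (a <= m)%N -> (m <= b)%N -> P a -> P m.
    elim: m => [|m IH]; first by rewrite leqn0 => /eqP->.
    rewrite leq_eqVlt => /orP[/eqP<- //|am] mb Pa.
    apply: (step m); [lia | lia | by rewrite ab // | apply: IH => //; lia].
  have down m : (a <= m)%N -> (m <= b)%N -> P m -> P a.
    elim: m => [|m IH]; first by rewrite leqn0 => /eqP->.
    rewrite leq_eqVlt => /orP[/eqP<- //|am] mb Pm.
    apply: IH; [lia | lia |].
    by apply: (step m.+1) Pm; rewrite ?ab ?orbT //; lia.
  by move=> ak kb /down /up; apply.
have base x y : (x <= rank t)%N -> (y <= rank t)%N ->
   edge t x y || edge t y x -> forall i k, (i == x) || (i == y) ->
   (k == x) || (k == y) -> P i -> P k.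
  move=> xt yt e i k /orP[]/eqP-> /orP[]/eqP-> // Pi.
    by apply: (step x).
  by apply: (step y) => //; rewrite orbC.
have glue (Q Q' : pred nat) x :
    (forall i k, Q i -> Q k -> P i -> P k) ->
    (forall i k, Q' i -> Q' k -> P i -> P k) -> Q x -> Q' x ->
    forall i k, Q i || Q' i -> Q k || Q' k -> P i -> P k.
  move=> HQ HQ' Qx Qx' i k /orP[Qi|Qi] /orP[Qk|Qk] Pi.
  - exact: HQ Pi.
  - by apply: (HQ' x) => //; apply: HQ Pi.
  - by apply: (HQ x) => //; apply: HQ' Pi.
  - exact: HQ' Pi.
have chainQ a b : (forall k, a <= k -> k < b -> edge t k k.+1)%N ->
    (b <= rank t)%N -> forall i k, (a <= i <= b)%N -> (a <= k <= b)%N ->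
    P i -> P k.
  by move=> ab bt i k /andP[? ?] /andP[? ?]; apply: (chainP a b).
move: Pi0.
case: t tv i0t jt step {chainP} base chainQ => [n|n||||n|n] /= tv it jt _ base ch.
- by apply: (ch 0 n)%N; lia.
- have H1 := ch 1%N n.-1 ltac:(move=> *; rewrite /edge; lia) ltac:(lia).
  have H2 := base 0%N 2%N ltac:(lia) ltac:(lia) ltac:(rewrite /edge; lia).
  have H3 := base (n - 2)%N n ltac:(lia) ltac:(lia) ltac:(rewrite /edge; lia).
  have H4 := glue _ _ 2%N H1 H2 ltac:(lia) ltac:(lia).
  have H5 := glue _ _ (n - 2)%N H4 H3 ltac:(lia) ltac:(lia).
  by apply: H5; lia.
- have H1 := ch 1%N 5%N ltac:(move=> *; rewrite /edge; lia) isT.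
  have H2 := base 3%N 6%N isT isT isT.
  have H3 := base 6%N 0%N isT isT isT.
  have H4 := glue _ _ 3%N H1 H2 isT isT.
  have H5 := glue _ _ 6%N H4 H3 isT isT.
  by apply: H5; lia.
- have H1 := ch 0%N 6%N ltac:(move=> *; rewrite /edge; lia) isT.
  have H2 := base 3%N 7%N isT isT isT.
  have H4 := glue _ _ 3%N H1 H2 isT isT.
  by apply: H4; lia.
- have H1 := ch 0%N 7%N ltac:(move=> *; rewrite /edge; lia) isT.
  have H2 := base 5%N 8%N isT isT isT.
  have H4 := glue _ _ 5%N H1 H2 isT isT.
  by apply: H4; lia.
- have H1 := ch 1%N n ltac:(move=> *; rewrite /edge; lia) ltac:(lia).
  have H2 := base 0%N 2%N ltac:(lia) ltac:(lia) ltac:(rewrite /edge; lia).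
  have H4 := glue _ _ 2%N H1 H2 ltac:(lia) ltac:(lia).
  by apply: H4; lia.
- by apply: (ch 0 n)%N; lia.
Qed.

(** * Column sums of the Cartan matrices *)

Lemma sum_ord_support (R : nmodType) N (s : seq nat) (f : nat -> R) : uniq s ->
  (forall i, i \in s -> i < N)%N ->
  (forall i, (i < N)%N -> i \notin s -> f i = 0) ->
  \sum_(i < N) f i = \sum_(i <- s) f i.
Proof.
move=> us sN f0; rewrite -(big_mkord xpredT f).
rewrite (bigID (mem s)) /= [X in _ + X]big1_seq ?addr0; last first.
  by move=> i /andP[nis]; rewrite mem_index_iota => /andP[_ iN]; apply: f0.
rewrite -big_filter; apply: perm_big; apply: uniq_perm => //.
  by rewrite filter_uniq // iota_uniq.
move=> i; rewrite mem_filter mem_index_iota leq0n /=.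
by case: (boolP (i \in s)) => //= /sN ->.
Qed.

Ltac eval_ifs :=
  repeat match goal with
  | |- context [if true then _ else _] => cbv iota
  | |- context [if false then _ else _] => cbv iota
  | |- context [if ?c then _ else _] =>
    first [ rewrite (_ : c = true); last by lia
          | rewrite (_ : c = false); last by lia ]
  end.

(** Restricts the sum over all nodes to a list [s] containing [j] and its neighbours, on which the
    Cartan entries are evaluated by arithmetic. *)
Ltac cartan_column w t j s :=
  rewrite (@sum_ord_support _ _ s (fun i => w i * cartan t i j));
  [ rewrite !big_cons big_nil /cartan !mem_edges /edge /comark ?inE; eval_ifs
  | rewrite /= ?inE; lia
  | move=> ?; rewrite ?inE /=; lia
  | move=> i ilt; rewrite ?inE => ini; rewrite /cartan !mem_edges /edge;
    eval_ifs; rewrite ?mulr0 // ].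

Lemma column_TypeA n j (w : nat -> int) : (2 <= n)%N -> (j <= n)%N ->
  \sum_(i < n.+1) w i * cartan (TypeA n) i j =
  w j * 2 - w (if j == 0 then n else j.-1)%N - w (if j == n then 0 else j.+1)%N.
Proof.
move=> n2 jn.
have [j0|j0] := eqVneq j 0%N.
  subst j; rewrite (_ : (0 == n)%N = false) /=; last by lia.
  by cartan_column w (TypeA n) 0%N [:: 0; 1; n]%N; lia.
have [jn'|jn'] := eqVneq j n.
  by subst j; cartan_column w (TypeA n) n [:: 0; n.-1; n]%N; lia.
by cartan_column w (TypeA n) j [:: j.-1; j; j.+1]; lia.
Qed.

Lemma column_TypeA1 j (w : nat -> int) : (j <= 1)%N ->
  \sum_(i < 2) w i * cartan (TypeA 1) i j = w j * 2 - w (1 - j)%N * 2.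
Proof.
by rewrite !big_ord_recr big_ord0; case: j => [|[|]] //= _;
  rewrite ?subn0 ?subnn /cartan /=; lia.
Qed.

Lemma column_TypeD n j (w : nat -> int) : (4 <= n)%N -> (j <= n)%N ->
  \sum_(i < n.+1) w i * cartan (TypeD n) i j =
  if (j <= 1)%N then w j * 2 - w 2%N
  else if (n - 1 <= j)%N then w j * 2 - w (n - 2)%N
  else w j * 2 - (if (j == 2)%N then w 0%N + w 1%N else w j.-1)
       - (if (j == n - 2)%N then w n.-1 + w n else w j.+1).
Proof.
move=> n4 jn.
have [j1|j1] := leqP j 1; first by cartan_column w (TypeD n) j [:: j; 2]%N; lia.
have [jn1|jn1] := leqP (n - 1) j.
  by cartan_column w (TypeD n) j [:: j; n - 2]%N; lia.
have [j2|j2] := eqVneq j 2%N; have [jn2|jn2] := eqVneq j (n - 2)%N.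
- by subst j; cartan_column w (TypeD n) 2%N [:: 0; 1; 2; n.-1; n]%N; lia.
- by subst j; cartan_column w (TypeD n) 2%N [:: 0; 1; 2; 3]%N; lia.
- by cartan_column w (TypeD n) j [:: j.-1; j; n.-1; n]%N; lia.
- by cartan_column w (TypeD n) j [:: j.-1; j; j.+1]%N; lia.
Qed.

Lemma column_TypeA2odd n j (w : nat -> int) : (3 <= n)%N -> (j <= n)%N ->
  \sum_(i < n.+1) w i * cartan (TypeA2odd n) i j =
  if (j <= 1)%N then w j * 2 - w 2%N
  else if (j == n)%N then w j * 2 - w n.-1 * 2
  else w j * 2 - (if (j == 2)%N then w 0%N + w 1%N else w j.-1) - w j.+1.
Proof.
move=> n3 jn.
have [j1|j1] := leqP j 1; first by cartan_column w (TypeA2odd n) j [:: j; 2]%N; lia.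
have [jn1|jn1] := eqVneq j n.
  by cartan_column w (TypeA2odd n) j [:: n.-1; j]%N; lia.
have [j2|j2] := eqVneq j 2%N.
  by subst j; cartan_column w (TypeA2odd n) 2%N [:: 0; 1; 2; 3]%N; lia.
by cartan_column w (TypeA2odd n) j [:: j.-1; j; j.+1]%N; lia.
Qed.

Lemma column_TypeD2 n j (w : nat -> int) : (2 <= n)%N -> (j <= n)%N ->
  \sum_(i < n.+1) w i * cartan (TypeD2 n) i j =
  w j * 2 - (if (j == 0)%N then 0 else if j == 1%N then w 0%N * 2 else w j.-1)
   - (if j == n then 0 else if j == n.-1 then w n * 2 else w j.+1).
Proof.
move=> n2 jn.
have [j0|j0] := eqVneq j 0%N.
  subst j; rewrite (_ : (0 == n)%N = false); last by lia.
  rewrite (_ : (0 == n.-1)%N = false); last by lia.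
  by cartan_column w (TypeD2 n) 0%N [:: 0; 1]%N; lia.
have [jn'|jn'] := eqVneq j n.
  subst j; rewrite (_ : (n == 1)%N = false); last by lia.
  by cartan_column w (TypeD2 n) n [:: n.-1; n]%N; lia.
have [j1|j1] := eqVneq j 1%N; have [j2|j2] := eqVneq j n.-1.
- by subst j; cartan_column w (TypeD2 n) 1%N [:: 0; 1; n]%N; lia.
- by subst j; cartan_column w (TypeD2 n) 1%N [:: 0; 1; 2]%N; lia.
- by cartan_column w (TypeD2 n) j [:: j.-1; j; n]%N; lia.
- by cartan_column w (TypeD2 n) j [:: j.-1; j; j.+1]%N; lia.
Qed.

Lemma comark_cartan t j : valid_type t -> (j <= rank t)%N ->
  \sum_(i < (rank t).+1) (comark t i)%:Z * cartan t i j = 0.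
Proof.
case: t => [n|n||||n|n] /= tv jt.
- have [n1|n1] := eqVneq n 1%N; first by subst n; rewrite (column_TypeA1 (fun=> 1)).
  by rewrite (column_TypeA (fun=> 1)) //; lia.
- rewrite (column_TypeD (fun i => (comark (TypeD n) i)%:Z)) //= !inE.
  by do ?case: ifP; lia.
- rewrite -(big_mkord xpredT (fun i => (comark TypeE6 i)%:Z * cartan TypeE6 i j)).
  by rewrite unlock; do 7 (case: j jt => [|j] jt; first by []).
- rewrite -(big_mkord xpredT (fun i => (comark TypeE7 i)%:Z * cartan TypeE7 i j)).
  by rewrite unlock; do 8 (case: j jt => [|j] jt; first by []).
- rewrite -(big_mkord xpredT (fun i => (comark TypeE8 i)%:Z * cartan TypeE8 i j)).
  by rewrite unlock; do 9 (case: j jt => [|j] jt; first by []).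
- rewrite (column_TypeA2odd (fun i => (comark (TypeA2odd n) i)%:Z)) //=.
  by do ?case: ifP; lia.
- rewrite (column_TypeD2 (fun i => (comark (TypeD2 n) i)%:Z)) //=.
  by do ?case: ifP; lia.
Qed.

Lemma forall_iota2 n (Q : nat -> nat -> bool) :
  all (fun j => all (Q j) (iota 0 n.+1)) (iota 0 n.+1) ->
  forall j k, (j <= n)%N -> (k <= n)%N -> Q j k.
Proof.
by move=> /allP h j k jn kn; have /h/allP : j \in iota 0 n.+1;
  rewrite ?mem_iota //; apply; rewrite mem_iota.
Qed.

(* The classes of the fundamental weights of comark 1 in P / Q are pairwise
   distinct; psi is a character of P / Q with values in Z / N. *)
Lemma comark1_separated t j k : valid_type t ->
  (j <= rank t)%N -> (k <= rank t)%N ->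
  comark t j = 1%N -> comark t k = 1%N -> j != k ->
  exists (N : nat) (psi : nat -> int),
    (forall i, (i <= rank t)%N ->
       (N %| \sum_(a < (rank t).+1) psi a * cartan t a i)%Z) /\
    ~~ (N %| psi j - psi k)%Z.
Proof.
case: t => [n|n||||n|n] /= tv jt kt cj ck jk.
(* In type A the class of [Lambda i] in Z / (n+1) is i. *)
- exists n.+1, Posz; split.
    move=> i it; have [n1|n1] := eqVneq n 1%N.
      by subst n; rewrite (column_TypeA1 Posz) //; lia.
    rewrite (column_TypeA Posz) //; last by lia.
    have [->|i0] := eqVneq i 0%N.
      by apply/dvdzP; exists (-1); case: ifP; lia.
    have [->|i1] := eqVneq i n; first by apply/dvdzP; exists 1; lia.
    by rewrite (_ : _ - _ = 0) ?dvdz0 //; lia.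
  apply/negP => /dvdzP[c].
  have [c0|c0] := ltrP c 0; first by nia.
  by have [c1|c1] := ltrP 0 c; nia.
- move: cj ck; rewrite !inE => cj ck.
  (* The character mod 4 separates 0 from 1 and n-1 from n; the character mod 2, the indicator of
     the two spin nodes, separates the two ends of the diagram. *)
  have [sep|sep] := boolP ((n - 1 <= j) == (n - 1 <= k))%N.
    exists 4%N, (fun i => if (i <= n - 2)%N then (i * 2)%:Z
                  else if i == n then n%:Z else (n - 2)%:Z).
    split; last by move: cj ck; do ?case: ifP; lia.
    by move=> i it; rewrite (column_TypeD (fun i => if (i <= n - 2)%N then (i * 2)%:Z
      else if i == n then n%:Z else (n - 2)%:Z)) //=; do ?case: ifP; lia.
  exists 2%N, (fun i => (n - 1 <= i)%N%:Z).
  split; last by lia.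
  by move=> i it; rewrite (column_TypeD (fun i => (n - 1 <= i)%N%:Z)) //=;
    do ?case: ifP; lia.
- exists 3%N, (fun i => (nth 0 [:: 0; 1; 2; 0; 1; 2; 0] i)%N%:Z); split.
    move=> i it; rewrite -(big_mkord xpredT (fun a =>
      (nth 0 [:: 0; 1; 2; 0; 1; 2; 0] a)%N%:Z * cartan TypeE6 a i)) unlock.
    by do 7 (case: i it => [|i] it; first by []).
  have /(_ j k jt kt) := @forall_iota2 6 (fun j k => [==> comark TypeE6 j == 1%N,
    comark TypeE6 k == 1%N, j != k =>
    ~~ (3 %| (nth 0 [:: 0; 1; 2; 0; 1; 2; 0] j)%N%:Z -
             (nth 0 [:: 0; 1; 2; 0; 1; 2; 0] k)%N%:Z)%Z]) isT.
  by rewrite /= cj ck jk.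
- exists 2%N, (fun i => (nth 0 [:: 0; 0; 0; 0; 1; 0; 1; 1] i)%N%:Z); split.
    move=> i it; rewrite -(big_mkord xpredT (fun a =>
      (nth 0 [:: 0; 0; 0; 0; 1; 0; 1; 1] a)%N%:Z * cartan TypeE7 a i)) unlock.
    by do 8 (case: i it => [|i] it; first by []).
  have /(_ j k jt kt) := @forall_iota2 7 (fun j k => [==> comark TypeE7 j == 1%N,
    comark TypeE7 k == 1%N, j != k =>
    ~~ (2 %| (nth 0 [:: 0; 0; 0; 0; 1; 0; 1; 1] j)%N%:Z -
             (nth 0 [:: 0; 0; 0; 0; 1; 0; 1; 1] k)%N%:Z)%Z]) isT.
  by rewrite /= cj ck jk.
(* Node 0 is the only one of comark 1 in E_8^(1), so there is nothing to separate. *)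
- have /(_ j k jt kt) := @forall_iota2 8 (fun j k => [==> comark TypeE8 j == 1%N,
    comark TypeE8 k == 1%N => j == k]) isT.
  by rewrite /= cj ck (negbTE jk).
- exists 2%N, Posz; split; last by move: cj ck; do ?case: ifP; lia.
  by move=> i it; rewrite (column_TypeA2odd Posz) //=; do ?case: ifP; lia.
- exists 2%N, (fun i => (i == n)%:Z); split; last by move: cj ck; do ?case: ifP; lia.
  move=> i it; rewrite (column_TypeD2 (fun i => (i == n)%:Z)) //=.
  by do ?case: ifP; lia.
Qed.

(* A maximum principle: the set where w_i / comark_i is maximal is closed
   under adjacency. *)
Lemma left_kernel t (w : node t -> int) : valid_type t ->
  (forall j : node t, \sum_(i < (rank t).+1) w i * cartan t i j = 0) ->
  forall i, w i = w ord0 * (comark t i)%:Z.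
Proof.
move=> tv wA.
have c0 (i : node t) : 0 < (comark t i)%:Z by rewrite ltz_nat comark_gt0 // -ltnS.
pose P (i : node t) := forall j, w j * (comark t i)%:Z <= w i * (comark t j)%:Z.
have [m Pm] : exists m, P m.
  case: (@arg_maxP _ rat _ ord0 xpredT (fun i => (w i)%:Q / (comark t i)%:Q)) => //.
  move=> m _ mP; exists m => j; move: (mP j isT) => /=.
  rewrite ler_pdivrMr ?ltr0z // mulrAC ler_pdivlMr ?ltr0z //.
  by rewrite -!intrM ler_int.
have step (i k : node t) : edge t i k || edge t k i -> P i -> P k.
  move=> ik Pi; have [<-//|ne] := eqVneq i k.
  have aik : cartan t k i != 0.
    apply: cartan_edge_neq0 ik; by rewrite eq_sym.
  (* Since [i] is maximal, each term with [j] different from [i] is a product of two nonpositive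
     numbers. The terms add up to 0, so all vanish, and at the neighbour [k] the Cartan entry is
     nonzero. *)
  have S0 : \sum_(j < (rank t).+1)
     (w j * (comark t i)%:Z - w i * (comark t j)%:Z) * cartan t j i = 0.
    rewrite (eq_bigr (fun j : node t => (comark t i)%:Z * (w j * cartan t j i)
      - w i * ((comark t j)%:Z * cartan t j i))) => [|j _]; last by ring.
    by rewrite sumrB -!mulr_sumr wA comark_cartan ?mulr0 ?subr0 // -ltnS.
  have nn (j : node t) : true ->
      0 <= (w j * (comark t i)%:Z - w i * (comark t j)%:Z) * cartan t j i.
    move=> _; have [<-|ji] := eqVneq i j; first by rewrite subrr mul0r.
    by rewrite mulr_le0 ?subr_le0 ?Pi // cartan_le0 // eq_sym.
  have /(_ k)/eqP := (fun k => psumr_eq0P nn S0 (i := k) isT).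
  rewrite mulf_eq0 (negbTE aik) orbF subr_eq0 => /eqP.
  move=> eqk j; rewrite -(ler_pM2r (c0 i)).
  rewrite mulrAC [leRHS]mulrAC eqk [leRHS]mulrAC.
  by rewrite ler_pM2r // Pi.
have allP k : P k.
  pose P' (n : nat) := forall k : node t, k = n :> nat -> P k.
  apply: (@diagram_connected t P' m k tv); rewrite ?leq_ord //.
    by move=> k' /val_inj->.
  move=> a b at_ bt ab Pa k' k'b.
  have at' : (a < (rank t).+1)%N by [].
  by apply: (step (Ordinal at')); rewrite ?k'b //; apply: Pa.
move=> i; apply/eqP; rewrite eq_le.
have := allP ord0 i; have := allP i ord0.
by rewrite /= !comark0 !mulr1 => -> ->.
Qed.

(** Scaling by [symm] transposes the Cartan matrix, which reduces this to [left_kernel]. *)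
Lemma right_kernel t (z : node t -> int) : valid_type t ->
  (forall i : node t, \sum_(j < (rank t).+1) cartan t i j * z j = 0) ->
  forall i : node t, (symm t i)%:Z * z i = z ord0 * (comark t i)%:Z.
Proof.
move=> tv Az i.
have h : forall j : node t,
    \sum_(i < (rank t).+1) ((symm t i)%:Z * z i) * cartan t i j = 0.
  move=> j; transitivity ((symm t j)%:Z * \sum_(k < (rank t).+1) cartan t j k * z k).
    rewrite mulr_sumr; apply: eq_bigr => k _.
    by rewrite mulrAC symm_cartan ?leq_ord // mulrA.
  by rewrite Az mulr0.
by rewrite (left_kernel tv h) /= symm0 // mul1r.
Qed.

(** Composing the comarks with a diagram automorphism gives another vector of the left kernel, hence
    a multiple of the comarks. Evaluated at the preimage of 0, this writes 1 as a product with
    factor [comark t r]. *)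
Lemma special_comark t (r : node t) : valid_type t -> special r -> comark t r = 1%N.
Proof.
move=> tv [s [sA <-]].
have h : forall j : node t,
    \sum_(i < (rank t).+1) (comark t (s i))%:Z * cartan t i j = 0.
  move=> j; rewrite -[RHS](@comark_cartan t (s j)) ?leq_ord //.
  rewrite [RHS](reindex_inj (@perm_inj _ s)).
  by apply: eq_bigr => i _; rewrite sA.
have /= := left_kernel tv h ((s^-1)%g ord0).
by rewrite permKV comark0 => /esym/eqP; rewrite -PoszM eqz_nat muln_eq1 => /andP[/eqP].
Qed.

(** As [nu] has level 0, adding [Lambda k] gives a dominant weight of level 1, that is, a
    fundamental weight of comark 1; by [comark1_separated] only [Lambda l] is in its class modulo
    the root lattice. It is applied to the nodes 0 and r in either order. *)
Lemma dominant_level1 t (k l : node t) (nu x : node t -> int) :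
  valid_type t -> comark t k = 1%N -> comark t l = 1%N ->
  (forall i, nu i = (i == l)%:Z - (i == k)%:Z
                    - \sum_(j < (rank t).+1) cartan t i j * x j) ->
  (forall i, i != k -> 0 <= nu i) -> -1 <= nu k ->
  forall i, nu i = (i == l)%:Z - (i == k)%:Z.
Proof.
move=> tv ck cl nuE nu0 nuk.
have pair (p : node t -> int) : \sum_i p i * nu i = p l - p k
    - \sum_(j < (rank t).+1) (\sum_(i < (rank t).+1) p i * cartan t i j) * x j.
  under eq_bigr do rewrite nuE mulrBr mulrBr.
  rewrite !sumrB; congr (_ - _ - _).
  - by rewrite (bigD1 l) //= eqxx mulr1 big1 ?addr0 // => i /negbTE->; rewrite mulr0.
  - by rewrite (bigD1 k) //= eqxx mulr1 big1 ?addr0 // => i /negbTE->; rewrite mulr0.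
  - under [RHS]eq_bigr do rewrite mulr_suml.
    rewrite exchange_big; apply: eq_bigr => i _; rewrite mulr_sumr.
    by apply: eq_bigr => j _; rewrite mulrA.
have lev : \sum_(i < (rank t).+1) (comark t i)%:Z * nu i = 0.
  rewrite (pair (fun i => (comark t i)%:Z)) ck cl subrr sub0r big1 ?oppr0 //.
  by move=> j _; rewrite comark_cartan ?mul0r // -ltnS.
suff [m [cm nuE']] : exists m : node t, comark t m = 1%N /\
    forall i, nu i = (i == m)%:Z - (i == k)%:Z.
  suff -> : l = m by [].
  apply/eqP/negPn/negP => lm.
  have [N [psi [psiA /negP[]]]] :=
    comark1_separated tv (leq_ord l) (leq_ord m) cl cm lm.
  have := pair (fun i => psi i).
  under eq_bigr do rewrite nuE' mulrBr.
  rewrite sumrB.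
  rewrite (bigD1 m) //= eqxx mulr1 big1 ?addr0 => [|i /negbTE->]; last by rewrite mulr0.
  rewrite (bigD1 k) //= eqxx mulr1 big1 ?addr0 => [|i /negbTE->]; last by rewrite mulr0.
  move=> e.
  have -> : psi l - psi m = (psi l - psi k) - (psi m - psi k) by ring.
  rewrite e subKr.
  by apply: rpred_sum => j _; apply: dvdz_mulr; apply: psiA; rewrite -ltnS.
have nn i : i != k -> 0 <= (comark t i)%:Z * nu i.
  by move=> ik; rewrite mulr_ge0 ?nu0.
have cgt (i : node t) : (comark t i)%:Z != 0.
  by have := @comark_gt0 t i; rewrite -ltnS ltn_ord; lia.
move/eqP: lev; rewrite (bigD1 k) //= ck mul1r addr_eq0 => /eqP lev.
have s0 : 0 <= - nu k by rewrite lev opprK sumr_ge0.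
(* If [nu k] is nonnegative, all terms of the level vanish. Otherwise it is -1, and is balanced by a
   single coefficient 1 at a node [m] of comark 1. *)
have [nuk0|nuk0] := lerP 0 (nu k).
  have z0 : \sum_(i < (rank t).+1 | i != k) (comark t i)%:Z * nu i = 0.
    by apply: oppr_inj; rewrite -[LHS]lev; lia.
  exists k; split => // i; rewrite subrr.
  have [->|ik] := eqVneq i k; first by lia.
  have /eqP := psumr_eq0P nn z0 ik.
  by rewrite mulf_eq0 (negbTE (cgt i)) => /eqP.
have [m mk num] : exists2 m : node t, m != k & nu m != 0.
  have [/existsP[m /andP[mk num]]|] :=
      boolP [exists m : node t, (m != k) && (nu m != 0)].
    by exists m.
  rewrite negb_exists => /forallP h.
  move: lev; rewrite big1 => [|i ik]; first by lia.
  by have := h i; rewrite ik negbK => /eqP->; rewrite mulr0.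
have nn' (i : node t) : (i != k) && (i != m) -> 0 <= (comark t i)%:Z * nu i.
  by move=> /andP[/nn].
move/eqP: lev; rewrite (bigD1 m) //= -addr_eq0 addrA addr_eq0 => /eqP lev.
have r0 : 0 <= - (nu k + (comark t m)%:Z * nu m).
  by rewrite lev opprK sumr_ge0.
have m0 := nu0 m mk; have cm := comark_gt0 (leq_ord m).
have cm1 : (comark t m)%:Z * nu m >= 1 by nia.
have e1 : (comark t m)%:Z * nu m = 1 by lia.
have num1 : nu m = 1 by nia.
exists m; split; first by rewrite num1 in e1; lia.
move=> i; have [->|ik] := eqVneq i k; first by rewrite eq_sym (negbTE mk); lia.
have [->|im] := eqVneq i m; first by lia.
have z0 : \sum_(i < (rank t).+1 | (i != k) && (i != m)) (comark t i)%:Z * nu i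
   = 0 by apply: oppr_inj; rewrite -[LHS]lev; lia.
have /eqP := psumr_eq0P nn' z0 (introT andP (conj ik im)).
by rewrite mulf_eq0 (negbTE (cgt i)) => /eqP->.
Qed.

(** * Weights of a saturated set below a minuscule weight *)

Section SaturatedWeights.
Variables (t : affine_type) (r : node t).
Hypotheses (tv : valid_type t) (r_special : special r) (r0 : r != ord0).

Let cr : comark t r = 1%N := special_comark tv r_special.

Lemma varpiE i : varpi r i = (i == r)%:Z - (i == ord0)%:Z.
Proof. by rewrite /varpi cr mulr1n !ffunE. Qed.

(** Weights are taken modulo [delta] and index 0 is allowed in [x], so [mu] determines [x] only up
    to a multiple of [delta]. *)
Definition below_varpi (mu : weight t) (x : node t -> int) : Prop :=
  forall i, mu i = varpi r i - \sum_(j < (rank t).+1) cartan t i j * x j.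

(* (varpi, varpi) - (mu, mu) for mu = varpi - \sum_i x_i alpha_i *)
Definition defect (mu : weight t) (x : node t -> int) : int :=
  \sum_(i < (rank t).+1) (symm t i)%:Z * x i * (mu i + varpi r i).

Lemma below_varpi_level mu x : below_varpi mu x ->
  \sum_(i < (rank t).+1) (comark t i)%:Z * mu i = 0.
Proof.
move=> mux; under eq_bigr do rewrite mux varpiE mulrBr mulrBr.
rewrite !sumrB [X in X - _ - _](bigD1 r) //= [X in _ - X - _](bigD1 ord0) //=.
rewrite eqxx [X in _ + X - _ - _]big1 => [|i /negbTE->]; last by rewrite mulr0.
rewrite cr comark0 !addr0 big1 => [|i /negbTE->]; last by rewrite mulr0.
rewrite addr0 subrr sub0r.
under eq_bigr do rewrite mulr_sumr.
rewrite exchange_big /= big1 ?oppr0 // => j _.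
under eq_bigr do rewrite mulrA.
by rewrite -mulr_suml comark_cartan ?mul0r // -ltnS.
Qed.

Lemma below_varpi_varpi : below_varpi (varpi r) (fun=> 0).
Proof.
by move=> i; rewrite big1 ?subr0 // => j _; rewrite mulr0.
Qed.

(** The difference lies in the right kernel: it is a multiple of [delta], whose i-th coefficient is
    [comark t i] divided by [symm t i]. *)
Lemma below_varpi_unique mu x x' : below_varpi mu x -> below_varpi mu x' ->
  forall i : node t, (symm t i)%:Z * (x i - x' i) = (x ord0 - x' ord0) * (comark t i)%:Z.
Proof.
move=> mux mux'; apply: (@right_kernel t (fun i => x i - x' i)) => // i.
under eq_bigr do rewrite mulrBr.
by rewrite sumrB; have := mux i; rewrite mux' => /addrI/oppr_inj->; rewrite subrr.
Qed.

(** A multiple of [delta] pairs with [mu + varpi r] to a multiple of its level, which is 0. *)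
Lemma defect_unique mu x x' : below_varpi mu x -> below_varpi mu x' ->
  defect mu x = defect mu x'.
Proof.
move=> mux mux'; apply/eqP; rewrite -subr_eq0 -sumrB.
under eq_bigr do rewrite -mulrBl -mulrBr (below_varpi_unique mux mux') mulrDr
  -!mulrA.
rewrite big_split /= -!mulr_sumr (below_varpi_level mux).
by rewrite (below_varpi_level below_varpi_varpi) mulr0.
Qed.

Definition shift (x : node t -> int) (a : node t) (n : int) : node t -> int :=
  fun i => x i - n * (i == a)%:Z.

Lemma alphaMz (a i : node t) n : (alpha a *~ n) i = cartan t i a * n.
Proof.
have p k : (alpha a *+ k) i = cartan t i a * k%:Z.
  by rewrite ffunMnE ffunE -[LHS]mulr_natr natz.
case: n => n; first exact: p.
by rewrite NegzE mulrNz ffunE -pmulrn p mulrN.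
Qed.

Lemma below_varpi_shift mu x a n : below_varpi mu x ->
  below_varpi (mu + alpha a *~ n) (shift x a n).
Proof.
move=> mux i; rewrite /shift.
under eq_bigr do rewrite mulrBr.
rewrite sumrB [X in _ - (_ - X)](bigD1 a) //= eqxx mulr1.
rewrite [X in _ - (_ - (_ + X))]big1 => [|j /negbTE->]; last by rewrite !mulr0.
rewrite ffunE alphaMz mux addr0 opprB; ring.
Qed.

(** Expansion of the norm of mu + n alpha_a. The correction vanishes at n = - [mu a], the simple
    reflection. *)
Lemma defect_shift mu x a n : below_varpi mu x ->
  defect (mu + alpha a *~ n) (shift x a n) =
  defect mu x - 2 * (symm t a)%:Z * n * (mu a + n).
Proof.
move=> mux; rewrite /defect /shift.
have e : \sum_(i < (rank t).+1) (symm t i)%:Z * x i * cartan t i a =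
    (symm t a)%:Z * (varpi r a - mu a).
  rewrite mux opprB addrC subrK mulr_sumr; apply: eq_bigr => i _.
  by rewrite mulrAC symm_cartan ?leq_ord // -mulrA.
rewrite (eq_bigr (fun i : node t => (symm t i)%:Z * x i * (mu i + varpi r i)
  + n * ((symm t i)%:Z * x i * cartan t i a)
  - (i == a)%:Z * ((symm t i)%:Z * n * (mu i + cartan t i a * n + varpi r i)))).
  rewrite sumrB big_split /= -mulr_sumr e.
  rewrite [X in _ - X](bigD1 a) //= eqxx mul1r.
  rewrite [X in _ - (_ + X)]big1 => [|j /negbTE->]; last by rewrite mul0r.
  by rewrite cartanii; ring.
by move=> i _; rewrite ffunE alphaMz; ring.
Qed.

(** The properties of the weights of V on which the combinatorics rests: they lie below [varpi r]
    for the classical roots, can be reflected upwards, and admit a step towards the middle of each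
    string. *)
Record saturated (W : weight t -> Prop) : Prop := {
  sat_top : forall mu, W mu -> exists c : node t -> nat,
    varpi r - mu = \sum_(i | i != ord0) alpha i *+ c i;
  sat_refl : forall mu a, W mu -> mu a < 0 -> W (mu + alpha a *~ (- mu a));
  sat_up : forall mu a, W mu -> mu a < 0 -> W (mu + alpha a *~ 1);
  sat_down : forall mu a, W mu -> 0 < mu a -> W (mu + alpha a *~ (-1))
}.

Variables (W : weight t -> Prop) (satW : saturated W).

(** Setting the coefficient at 0 to 0 removes the ambiguity by [delta] and makes the sum of [c] a
    measure for induction. *)
Lemma sat_height mu : W mu -> exists c : node t -> nat,
  c ord0 = 0%N /\ below_varpi mu (fun i => (c i)%:Z).
Proof.
move=> /(sat_top satW)[c e].
exists (fun i => if i == ord0 then 0%N else c i); split; first by rewrite eqxx.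
move=> i; have -> : mu = varpi r - (varpi r - mu) by rewrite subKr.
rewrite e ffunE [X in _ + X]ffunE sum_ffunE; congr (_ - _).
rewrite [RHS](bigID (fun j => j != ord0)) /= [X in _ + X]big1; last first.
  by move=> j; rewrite negbK => ->; rewrite mulr0.
rewrite addr0; apply: eq_bigr => j /negbTE->.
by rewrite ffunMnE ffunE -[LHS]mulr_natr natz.
Qed.

Lemma sat_height_shift mu (c : node t -> nat) a n : c ord0 = 0%N ->
  below_varpi mu (fun i => (c i)%:Z) -> a != ord0 -> 0 < n ->
  W (mu + alpha a *~ n) ->
  exists c' : node t -> nat, [/\ c' ord0 = 0%N,
    below_varpi (mu + alpha a *~ n) (fun i => (c' i)%:Z)
    & (\sum_i c' i < \sum_i c i)%N].
Proof.
move=> c0 muc a0 n0 Wmu'; have [c' [c'0 muc']] := sat_height Wmu'.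
exists c'; split => //; have shc := below_varpi_shift a n muc.
(* Both sides have coefficient 0 at node 0, so no multiple of [delta] is left between them. *)
have cc' i : c' i = shift (fun i => (c i)%:Z) a n i :> int.
  have := below_varpi_unique muc' shc i.
  rewrite {2}/shift c0 c'0 eq_sym (negbTE a0) mulr0 subr0 mul0r => /eqP.
  rewrite mulf_eq0 subr_eq0 => /orP[|/eqP//].
  by have := symm_gt0 t i; lia.
rewrite -ltz_nat !(big_morph Posz PoszD (erefl 0)).
under eq_bigr do rewrite cc'.
rewrite /shift sumrB [X in _ - X](bigD1 a) //= eqxx mulr1.
rewrite [X in _ - (_ + X)]big1 => [|j /negbTE->]; last by rewrite mulr0.
by rewrite addr0 gtrBl.
Qed.

(** No alpha_0 is subtracted from [varpi r], and the other simple roots are nonpositive on h_0. So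
    [mu] is at least -1 there, and [dominant_level1] applies with k = 0. *)
Lemma sat_dominant mu : W mu -> (forall a, a != ord0 -> 0 <= mu a) ->
  mu = varpi r.
Proof.
move=> Wmu mu0; have [c [c0 muc]] := sat_height Wmu.
apply/ffunP => i; rewrite varpiE.
apply: (@dominant_level1 t ord0 r mu (fun i => (c i)%:Z) tv (comark0 t) cr) => //.
  by move=> j; rewrite muc varpiE.
rewrite muc varpiE eqxx eq_sym (negbTE r0) sub0r lerDl oppr_ge0.
apply: sumr_le0 => j _; have [->|j0] := eqVneq j ord0; first by rewrite c0 mulr0.
by rewrite mulr_le0_ge0 // cartan_le0 // eq_sym.
Qed.

(** Reflections at classical nodes where [mu] is negative preserve the defect and lower the height;
    they end at [varpi r], of defect 0. *)
Lemma sat_defect mu x : W mu -> below_varpi mu x -> defect mu x = 0.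
Proof.
move=> Wmu mux; have [c [c0 muc]] := sat_height Wmu.
rewrite (defect_unique mux muc) => {x mux}.
have [n] := ubnP (\sum_i c i)%N; elim: n mu c Wmu c0 muc => // n IH mu c Wmu c0 muc.
move=> cn.
have [/existsP[a /andP[a0 mua]]|] := boolP [exists a, (a != ord0) && (mu a < 0)].
  have Wmu' := sat_refl satW Wmu mua; have na : 0 < - mu a by rewrite oppr_gt0.
  have [c' [c'0 muc' cc']] := sat_height_shift c0 muc a0 na Wmu'.
  have := defect_shift a (- mu a) muc.
  rewrite addrN mulr0 subr0 => <-.
  rewrite (defect_unique (below_varpi_shift a _ muc) muc'); apply: IH => //.
  exact: leq_trans cc' cn.
rewrite negb_exists => /forallP h.
have muv : mu = varpi r.
  by apply: sat_dominant => // a a0; have := h a; rewrite a0 /= -leNgt.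
rewrite (@defect_unique _ _ (fun=> 0) muc); last by rewrite muv; apply: below_varpi_varpi.
by rewrite /defect big1 // => i _; rewrite mulr0 mul0r.
Qed.

(** If [mu a] had absolute value at least 2, the next weight of its string would have positive
    defect by [defect_shift]. *)
Lemma sat_minuscule mu a : W mu -> -1 <= mu a <= 1.
Proof.
move=> Wmu; have [c [c0 muc]] := sat_height Wmu.
have s0 := symm_gt0 t a; have d0 := sat_defect Wmu muc.
apply/andP; split; rewrite leNgt; apply/negP => mua.
  have Wmu' := @sat_up _ satW mu a Wmu ltac:(lia).
  have := sat_defect Wmu' (below_varpi_shift a 1 muc).
  by rewrite defect_shift // d0; nia.
have Wmu' := @sat_down _ satW mu a Wmu ltac:(lia).
have := sat_defect Wmu' (below_varpi_shift a (-1) muc).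
by rewrite defect_shift // d0; nia.
Qed.

(** This is [dominant_level1] for [- mu], with 0 and r exchanged; the bound at r comes from
    [sat_minuscule]. *)
Lemma sat_antidominant mu : W mu -> (forall a, a != r -> mu a <= 0) ->
  mu = varpi r.
Proof.
move=> Wmu mu0; have [c [c0 muc]] := sat_height Wmu.
apply/ffunP => i; rewrite varpiE; apply: oppr_inj; rewrite opprB.
apply: (@dominant_level1 t r ord0 (fun i => - mu i) (fun i => - (c i)%:Z) tv cr
  (comark0 t)).
- move=> j; rewrite muc varpiE.
  by under [in RHS]eq_bigr do rewrite mulrN; rewrite sumrN; ring.
- by move=> a /mu0; lia.
- by have := sat_minuscule r Wmu; lia.
Qed.

End SaturatedWeights.

(** * Quantum sl_2 and the weights of V *)

Section Diagonal.
Variables (K : fieldType) (V : vectType K) (I : eqType) (P : I -> V -> Prop).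

Definition diagonal (T : 'End(V)) (chi : I -> K) : Prop :=
  forall mu v, P mu v -> T v = chi mu *: v.

Hypothesis separated : forall mu nu, mu != nu ->
  exists T chi, [/\ diagonal T chi, chi nu = 1 & chi mu = 0].

Lemma diagonal_projector nu (s : seq I) : nu \notin s ->
  exists T chi, [/\ diagonal T chi, chi nu = 1 & {in s, forall mu, chi mu = 0}].
Proof.
elim: s => [|mu s IH]; first by exists \1%VF, (fun=> 1); split => // mu v _;
  rewrite id_lfunE scale1r.
rewrite inE negb_or eq_sym => /andP[/separated[T [chi [Tchi chinu chimu]]]].
move=> /IH[T' [chi' [Tchi' chinu' chis]]].
exists (T \o T')%VF, (fun la => chi la * chi' la); split.
- move=> la v Pv; rewrite lfunE /= (Tchi' la) // linearZ /= (Tchi la) //.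
  by rewrite scalerA mulrC.
- by rewrite chinu chinu' mulr1.
- move=> la; rewrite inE => /orP[/eqP->|/chis->]; first by rewrite chimu mul0r.
  by rewrite mulr0.
Qed.

(** An operator that kills all the vectors but one shows that they are linearly independent. *)
Lemma diagonal_size (s : seq I) (x : I -> V) : uniq s ->
  {in s, forall mu, P mu (x mu) /\ x mu != 0} -> (size s <= \dim {:V})%N.
Proof.
move=> us Px; have : free (map x s).
  elim: s us Px => [|mu s IH] /=; first by rewrite nil_free.
  move=> /andP[mus us] Px; rewrite free_cons IH ?andbT //; last first.
    by move=> la las; apply: Px; rewrite inE las orbT.
  apply/negP => xs; have [T [chi [Tchi chimu chis]]] := diagonal_projector mus.
  have [Pmu /eqP[]] := Px mu (mem_head _ _).
  have /subvP/(_ _ xs) : (<<map x s>> <= lker T)%VS.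
    apply/span_subvP => _ /mapP[la las ->]; rewrite memv_ker.
    rewrite (Tchi la) ?chis ?scale0r //.
    by have [] := Px la; rewrite ?inE ?las ?orbT.
  by rewrite memv_ker (Tchi mu) // chimu scale1r => /eqP.
rewrite /free size_map => /eqP<-; exact: dimvS (subvf _).
Qed.

Lemma diagonal_component (nu : I) (s : seq (I * V)) v :
  (forall x, x \in s -> P x.1 x.2) -> P nu v -> v = \sum_(x <- s) x.2 ->
  v = \sum_(x <- s | x.1 == nu) x.2.
Proof.
move=> Ps Pv vs.
have nus : nu \notin [seq x.1 | x <- s & x.1 != nu].
  by apply/mapP => -[x]; rewrite mem_filter => /andP[/eqP ne _] /esym.
have [T [chi [Tchi chinu chis]]] := diagonal_projector nus.
have -> : v = T v by rewrite (Tchi nu) // chinu scale1r.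
rewrite vs linear_sum (bigID (fun x => x.1 == nu)) /=.
rewrite [X in _ + X]big1_seq ?addr0; last first.
  move=> x /andP[xnu xs]; rewrite (Tchi x.1 _ (Ps x xs)) chis ?scale0r //.
  by apply/mapP; exists x => //; rewrite mem_filter xnu.
rewrite big_seq_cond [RHS]big_seq_cond; apply: eq_bigr => x /andP[xs /eqP e].
by rewrite (Tchi x.1 _ (Ps x xs)) e chinu scale1r.
Qed.

End Diagonal.

(** * Finite-dimensional representations of quantum sl_2 *)

Section QuantumSl2.
Variables (K : fieldType) (V : vectType K) (p : K).
Hypotheses (p0 : p != 0) (p_free : forall n : int, p ^ n = 1 -> n = 0).

Definition qbr (n : int) : K := (p ^ n - p ^ (- n)) / (p - p^-1).

Lemma exp_inj : injective (fun n : int => p ^ n).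
Proof.
move=> m n e; apply/eqP; rewrite -subr_eq0; apply/eqP/p_free.
by rewrite expfzDr // e -expfzDr // subrr.
Qed.

Lemma subV_neq0 : p - p^-1 != 0.
Proof.
rewrite subr_eq0; apply/negP => /eqP e.
by have := @exp_inj 1 (-1); rewrite expr1z exprN1 => /(_ e).
Qed.

Lemma qbr_neq0 n : n != 0 -> qbr n != 0.
Proof.
move=> n0; rewrite mulf_neq0 ?invr_eq0 ?subV_neq0 // subr_eq0.
by apply/negP => /eqP/exp_inj; move/eqP: n0; lia.
Qed.

Lemma qbr0 : qbr 0 = 0. Proof. by rewrite /qbr oppr0 subrr mul0r. Qed.

Lemma qbr1 : qbr 1 = 1.
Proof. by rewrite /qbr expr1z exprN1 divff ?subV_neq0. Qed.

(** The identity of q-integers behind the induction step of [E_iterF]. *)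
Lemma qbrS (k : nat) n :
  qbr k.+1 * qbr (n - k%:Z) + qbr (n - 2 * k.+1%:Z) =
  qbr k.+2 * qbr (n - k.+1%:Z).
Proof.
have pn m : p ^ m != 0 by rewrite expfz_neq0.
rewrite /qbr (_ : k.+2%:Z = k%:Z + 1 + 1); last by lia.
rewrite (_ : k.+1%:Z = k%:Z + 1); last by lia.
rewrite (_ : n - 2 * (k%:Z + 1) = n - k%:Z - k%:Z - 1 - 1); last by lia.
rewrite -!invr_expz !expfzDr // -!invr_expz !expfzDr // !expr1z.
have h := subV_neq0.
move: (pn n) (pn k%:Z); move: (p ^ n) (p ^ k%:Z) => a b a0 b0.
have h2 : p * p - 1 != 0.
  apply: contra h => e; rewrite (_ : p - p^-1 = (p * p - 1) / p) ?mulf_eq0 ?e //.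
  by field.
by field; rewrite b0 a0 p0 h2.
Qed.

Record q_sl2 (E F Kop Kinv : 'End(V)) : Prop := {
  sl2_KK : forall v, Kinv (Kop v) = v;
  sl2_KV : forall v, Kop (Kinv v) = v;
  sl2_KE : forall v, Kop (E v) = p ^ 2 *: E (Kop v);
  sl2_KF : forall v, Kop (F v) = p ^ (-2) *: F (Kop v);
  sl2_EF : forall v, E (F v) - F (E v) = (p - p^-1)^-1 *: (Kop v - Kinv v)
}.

(** This symmetry carries statements on raising operators over to lowering operators. *)
Lemma q_sl2_sym E F Kop Kinv : q_sl2 E F Kop Kinv -> q_sl2 F E Kinv Kop.
Proof.
move=> H; split; try by case: H.
- move=> v; rewrite -{1}(sl2_KV H v) -[F (Kop _)](scale1r).
  rewrite -(expr0z p) (_ : 0 = 2 + -2) // expfzDr // -scalerA -(sl2_KF H).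
  by rewrite linearZ /= (sl2_KK H).
- move=> v; rewrite -{1}(sl2_KV H v) -[E (Kop _)](scale1r).
  rewrite -(expr0z p) (_ : 0 = -2 + 2) // expfzDr // -scalerA -(sl2_KE H).
  by rewrite linearZ /= (sl2_KK H).
- by move=> v; rewrite -opprB (sl2_EF H) -scalerN opprB.
Qed.

Section Triple.
Variables (E F Kop Kinv : 'End(V)) (H : q_sl2 E F Kop Kinv).

Definition wt (n : int) (v : V) : Prop := Kop v = p ^ n *: v.

Lemma wt_sep m n : m != n ->
  exists T chi, [/\ diagonal wt T chi, chi n = 1 & chi m = 0].
Proof.
move=> mn; have d0 : p ^ n - p ^ m != 0.
  by rewrite subr_eq0; apply: contra mn => /eqP/exp_inj->.
exists ((p ^ n - p ^ m)^-1 *: (Kop - p ^ m *: \1))%VF,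
  (fun k => (p ^ k - p ^ m) / (p ^ n - p ^ m)); split.
- move=> k v wv; rewrite !(scale_lfunE, add_lfunE, opp_lfunE, id_lfunE).
  by rewrite wv -scalerBl scalerA mulrC.
- by rewrite divff.
- by rewrite subrr mul0r.
Qed.

Lemma wtE n v : wt n v -> wt (n + 2) (E v).
Proof.
by rewrite /wt => wv; rewrite (sl2_KE H) wv linearZ scalerA expfzDr // mulrC.
Qed.

Lemma wtF n v : wt n v -> wt (n - 2) (F v).
Proof.
by rewrite /wt => wv; rewrite (sl2_KF H) wv linearZ scalerA expfzDr // mulrC.
Qed.

Lemma wtB n v w : wt n v -> wt n w -> wt n (v - w).
Proof. by rewrite /wt => wv ww; rewrite linearB /= wv ww -scalerBr. Qed.

Lemma wtZ n a v : wt n v -> wt n (a *: v).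
Proof. by rewrite /wt => wv; rewrite linearZ /= wv !scalerA mulrC. Qed.

Lemma wt_iterF n k v : wt n v -> wt (n - 2 * k%:Z) (iter k F v).
Proof.
move=> wv; elim: k => [|k IH] /=; first by rewrite mulr0 subr0.
by have := wtF IH; congr wt; lia.
Qed.

Lemma wt_iterE n k v : wt n v -> wt (n + 2 * k%:Z) (iter k E v).
Proof.
move=> wv; elim: k => [|k IH] /=; first by rewrite mulr0 addr0.
by have := wtE IH; congr wt; lia.
Qed.

Lemma EF_wt n v : wt n v -> E (F v) = F (E v) + qbr n *: v.
Proof.
move=> wv; have wv' : Kinv v = p ^ (- n) *: v.
  rewrite -{2}(sl2_KK H v) wv linearZ scalerA -expfzDr // addNr expr0z.
  by rewrite scale1r.
have := sl2_EF H v; rewrite wv wv' -scalerBl scalerA mulrC => <-.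
by rewrite addrC subrK.
Qed.

Lemma E_iterF n k v : wt n v -> E (iter k.+1 F v) =
  iter k.+1 F (E v) + (qbr k.+1 * qbr (n - k%:Z)) *: iter k F v.
Proof.
move=> wv; elim: k => [|k IH].
  by rewrite /= (EF_wt wv) qbr1 mul1r subr0.
rewrite [iter k.+2 F v]/= -/(iter k.+1 F v) (EF_wt (wt_iterF k.+1 wv)) IH.
by rewrite linearD linearZ /= -addrA -scalerDl qbrS.
Qed.

(** Otherwise every [iter k F v] is nonzero, because the coefficients in [E_iterF] do not vanish at
    negative weight; infinitely many distinct weights contradict finite dimension. *)
Lemma wt_neg_eq0 n v : wt n v -> n < 0 -> F (E v) = 0 -> v = 0.
Proof.
move=> wv n0 FE; apply/eqP/negPn/negP => v0.
have Fk k : iter k F v != 0.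
  elim: k => // k IH; apply/negP => /eqP e.
  have := E_iterF k wv; rewrite e linear0 iterSr FE.
  have -> : iter k F 0 = 0 by elim: k {IH e} => //= k ->; rewrite linear0.
  rewrite add0r => /esym/eqP; rewrite scaler_eq0 (negbTE IH) orbF mulf_eq0.
  by apply/negP; rewrite negb_or !qbr_neq0 //; lia.
suff : ((\dim {:V}).+1 <= \dim {:V})%N by rewrite ltnn.
rewrite -{1}(size_iota 0 (\dim {:V}).+1) -(size_map (fun k : nat => n - 2 * k%:Z)).
(* The index k is recovered from the weight m = n - 2k. *)
apply: (diagonal_size wt_sep (x := fun m => iter (absz ((n - m) %/ 2)%Z) F v)).
  by rewrite map_inj_uniq ?iota_uniq // => k l; lia.
move=> _ /mapP[k _ ->].
have -> : absz ((n - (n - 2 * k%:Z)) %/ 2)%Z = k by lia.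
by split => //; apply: wt_iterF.
Qed.

Lemma iterE_iterF n k v : wt n v -> E v = 0 -> k%:Z <= n ->
  exists2 c, c != 0 & iter k E (iter k F v) = c *: v.
Proof.
move=> wv Ev; elim: k => [|k IH] kn; first by exists 1; rewrite ?oner_eq0 ?scale1r.
have [|c c0 e] := IH; first by lia.
exists (c * (qbr k.+1 * qbr (n - k%:Z))).
  by apply: mulf_neq0 => //; apply: mulf_neq0; apply: qbr_neq0; lia.
rewrite iterSr (E_iterF k wv) Ev.
have -> : iter k.+1 F 0 = 0 by elim: k.+1 => //= l ->; rewrite linear0.
rewrite add0r.
have -> : forall (a : K) w, iter k E (a *: w) = a *: iter k E w.
  by move=> a w; elim: (k) => //= l ->; rewrite linearZ.
by rewrite e scalerA mulrC.
Qed.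

(** For m at least 2 put y = E^(m-1) v, which E kills. By induction E v is a multiple of F^(m-2) y,
    and F^(m-1) y = 0; hence F E v = 0 and [wt_neg_eq0] applies. *)
Lemma iterE_inj m v : wt (- m%:Z) v -> iter m E v = 0 -> v = 0.
Proof.
have [n] := ubnP m; elim: n m v => // n IH [|[|m]] v mn wv //.
  by rewrite /= => Ev; apply: (wt_neg_eq0 wv) => //; rewrite Ev linear0.
move=> Ev; pose y := iter m.+1 E v.
have wy : wt m y by have := wt_iterE m.+1 wv; congr wt; lia.
have Ey : E y = 0 by [].
have [c c0 e] := iterE_iterF wy Ey (lexx m%:Z).
have Fy : iter m.+1 F y = 0.
  have := wt_iterF m.+1 wy; move/wt_neg_eq0; apply; first by lia.
  rewrite (E_iterF m wy) Ey subrr qbr0 mulr0 scale0r addr0.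
  have -> : iter m.+1 F 0 = 0 by elim: m.+1 => //= l ->; rewrite linear0.
  by rewrite linear0.
have iterB k w w' : iter k E (w - w') = iter k E w - iter k E w'.
  by elim: k => //= k ->; rewrite linearB.
have iterZ k a w : iter k E (a *: w) = a *: iter k E w.
  by elim: k => //= k ->; rewrite linearZ.
have : E v - c^-1 *: iter m F y = 0.
  apply: (IH m); [lia | | ].
    apply: wtB; first by have := wtE wv; congr wt; lia.
    by apply: wtZ; have := wt_iterF m wy; congr wt; lia.
  by rewrite iterB iterZ e scalerA mulVf // scale1r -iterSr subrr.
move=> /eqP; rewrite subr_eq0 => /eqP Ev'.
apply: (wt_neg_eq0 wv) => //.
by rewrite Ev' linearZ /= [F _]Fy scaler0.
Qed.

End Triple.
End QuantumSl2.

Lemma q_neq0 : q != 0.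
Proof. by rewrite /q tofrac_eq0 polyX_eq0. Qed.

Lemma q_free (n : int) : q ^ n = 1 -> n = 0.
Proof.
have qX k : q ^+ k = 1 -> k = 0%N.
  rewrite /q -rmorphXn -[1]tofrac1 => /eqP; rewrite tofrac_eq => /eqP.
  by move/(congr1 (fun p : {poly rat} => size p)); rewrite size_polyXn size_poly1 => -[].
case: n => n; first by rewrite -exprnP => /qX->.
rewrite NegzE -exprnN => /(congr1 (fun x => x^-1)).
by rewrite invrK invr1 => /qX.
Qed.

Lemma q_i_neq0 t (i : node t) : q_ i != 0.
Proof. by rewrite /q_ expf_neq0 // q_neq0. Qed.

Lemma q_i_free t (i : node t) (n : int) : q_ i ^ n = 1 -> n = 0.
Proof.
rewrite /q_ exprnP exprz_exp => /q_free.
by have := symm_gt0 t i; nia.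
Qed.

(** * Weights of the Kirillov-Reshetikhin module *)

Section QuantumAffineModule.
Variables (t : affine_type) (V : vectType Qq) (M : Uq_action t V).
Hypothesis MU : Uq_module M.

Lemma Uq_sl2 i : q_sl2 (q_ i) (actE M i) (actF M i) (actK M i) (actKinv M i).
Proof.
split; [exact: (Uq_KinvK MU) | exact: (Uq_KKinv MU) | | |] => v.
- by rewrite (Uq_KE MU) cartanii.
- by rewrite (Uq_KF MU) cartanii.
- by rewrite (Uq_EF MU) eqxx.
Qed.

Lemma in_wtE mu i v : in_wt M mu v -> in_wt M (mu + alpha i) (actE M i v).
Proof.
move=> wv j; rewrite (Uq_KE MU) wv linearZ /= scalerA !ffunE addrC.
by rewrite expfzDr ?q_i_neq0 // mulrC.
Qed.

Lemma in_wtF mu i v : in_wt M mu v -> in_wt M (mu - alpha i) (actF M i v).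
Proof.
move=> wv j; rewrite (Uq_KF MU) wv linearZ /= scalerA !ffunE addrC.
by rewrite expfzDr ?q_i_neq0 // mulrC.
Qed.

Lemma in_wt_iterE mu i k v : in_wt M mu v ->
  in_wt M (mu + alpha i *+ k) (iter k (actE M i) v).
Proof.
move=> wv; elim: k => [|k IH]; first by rewrite mulr0n addr0.
by rewrite mulrSr addrA /=; apply: in_wtE.
Qed.

Lemma in_wtZ mu a v : in_wt M mu v -> in_wt M mu (a *: v).
Proof. by move=> wv j; rewrite linearZ /= wv !scalerA mulrC. Qed.

Lemma in_wt0 mu : in_wt M mu 0.
Proof. by move=> j; rewrite linear0 scaler0. Qed.

Lemma in_wt_sep (mu nu : weight t) : mu != nu ->
  exists T chi, [/\ diagonal (in_wt M) T chi, chi nu = 1 & chi mu = 0].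
Proof.
move=> ne; have [i nei] : exists i, mu i != nu i.
  apply/existsP; rewrite -negb_forall; apply: contra ne => /forallP h.
  by apply/eqP/ffunP => i; apply/eqP.
have [T [chi [Tchi chin chim]]] :=
  wt_sep (q_i_neq0 i) (q_i_free (i := i)) (actK M i) nei.
by exists T, (fun la : weight t => chi (la i)); split => // la v wv; apply: Tchi.
Qed.

Definition is_weight (mu : weight t) : Prop := exists2 v, v != 0 & in_wt M mu v.

(** The weight vectors required are E^m v, E v and F v. They are nonzero by quantum sl_2, the last
    one through [q_sl2_sym]. *)
Lemma KR_saturated (r : node t) :
  has_highest_weight M (varpi r) -> saturated r is_weight.
Proof.
move=> [_ top]; split.
- by move=> mu [v v0 wv]; apply: top wv v0.
- move=> mu a [v v0 wv] mua; have [m muam] : exists m : nat, mu a = - m%:Z.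
    by exists (absz (mu a)); lia.
  exists (iter m (actE M a) v).
    apply: contra v0 => /eqP e; apply/eqP.
    apply: (iterE_inj (q_i_neq0 a) (@q_i_free t a) (Uq_sl2 a) _ e).
    by rewrite -muam; apply: wv.
  by rewrite muam opprK -pmulrn; apply: in_wt_iterE.
- move=> mu a [v v0 wv] mua; exists (actE M a v); last exact: in_wtE.
  apply: contra v0 => /eqP e; apply/eqP.
  apply: (wt_neg_eq0 (q_i_neq0 a) (@q_i_free t a) (Uq_sl2 a) (wv a) mua).
  by rewrite e linear0.
- move=> mu a [v v0 wv] mua; exists (actF M a v); last exact: in_wtF.
  apply: contra v0 => /eqP e; apply/eqP.
  apply: (@wt_neg_eq0 _ _ _ (q_i_neq0 a) (@q_i_free t a) _ _ _ _
    (q_sl2_sym (q_i_neq0 a) (Uq_sl2 a)) (- mu a)); last by rewrite e linear0.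
    rewrite /wt -{2}(Uq_KinvK MU a v) wv linearZ /= scalerA -expfzDr ?q_i_neq0 //.
    by rewrite addNr expr0z scale1r.
  by rewrite oppr_lt0.
Qed.

End QuantumAffineModule.

(** * Rational functions regular at q = 0 *)

Lemma fraction_quotient (R : idomainType) (x : {fraction R}) :
  exists n d : R, d != 0 /\ x = tofrac n / tofrac d.
Proof.
elim/quotW: x => r; exists \n_r, \d_r; split; first exact: denom_ratioP.
have d0 : tofrac \d_r != 0 :> {fraction R} by rewrite tofrac_eq0 denom_ratioP.
apply: (mulIf d0); rewrite mulfVK //.
unlock FracField.tofrac; rewrite -[LHS]FracField.pi_mul.
apply/eqmodP; rewrite /= FracField.equivfE /FracField.mulf.
by rewrite !numden_Ratio ?oner_eq0 ?mulr1 ?denom_ratioP // mulrC.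
Qed.

Lemma regular0_tofrac (p : {poly rat}) : regular0 (tofrac p).
Proof.
by exists p, 1; split; rewrite ?hornerC ?oner_eq0 // tofrac1 divr1.
Qed.

Lemma horner0_neq0 (d : {poly rat}) : d.[0] != 0 -> tofrac d != 0.
Proof. by rewrite tofrac_eq0; apply: contra => /eqP->; rewrite horner0. Qed.

Lemma regular0M x y : regular0 x -> regular0 y -> regular0 (x * y).
Proof.
move=> [n [d [d0 ->]]] [n' [d' [d'0 ->]]]; exists (n * n'), (d * d').
by rewrite hornerM mulf_neq0 // !tofracM mulf_div.
Qed.

Lemma regular0D x y : regular0 x -> regular0 y -> regular0 (x + y).
Proof.
move=> [n [d [d0 ->]]] [n' [d' [d'0 ->]]]; exists (n * d' + n' * d), (d * d').
rewrite hornerM mulf_neq0 //; split => //.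
by rewrite addf_div ?horner0_neq0 // tofracD !tofracM.
Qed.

Lemma regular0_0 : regular0 0.
Proof. by rewrite -[0]tofrac0; apply: regular0_tofrac. Qed.

Lemma regular0_opp1 : regular0 (-1).
Proof. by rewrite -tofrac1 -tofracN; apply: regular0_tofrac. Qed.

(** The residue is the value at q = 0: the numerator of the difference has root 0, hence is
    divisible by X. *)
Lemma regular0_residue x : regular0 x -> exists a, regular0 (q^-1 * (x - qcst a)).
Proof.
move=> [n [d [d0 ->]]]; exists (n.[0] / d.[0]).
have /factor_theorem[m e] : root (n - (n.[0] / d.[0])%:P * d) 0.
  by rewrite rootE hornerD hornerN hornerM hornerC divfK ?subrr.
exists m, d; split => //.
have d0' := horner0_neq0 d0.
have -> : tofrac n / tofrac d - qcst (n.[0] / d.[0]) =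
    tofrac (n - (n.[0] / d.[0])%:P * d) / tofrac d.
  by rewrite tofracB tofracM mulrBl mulfK.
by rewrite e subr0 tofracM mulrA [q^-1 * _]mulrC mulfK ?q_neq0.
Qed.

Lemma expf_quotient (K : fieldType) (x y z : K) (a b : nat) : z != 0 -> (b <= a)%N ->
  x * z ^+ a / (y * z ^+ b) = x * z ^+ (a - b) / y.
Proof.
move=> z0 /subnK{1}<-; rewrite exprD mulrA -mulf_div divff ?mulr1 //.
by rewrite expf_neq0.
Qed.

(** Extracting the powers of X from numerator and denominator leaves a unit of the local ring times
    a power of q. *)
Lemma regular0_valuation x : regular0 x \/ regular0 x^-1.
Proof.
have [n [d [d0 xE]]] := fraction_quotient x.
have [->|x0] := eqVneq x 0; first by left; apply: regular0_0.
have n0 : n != 0 by apply: contra x0 => /eqP e; rewrite xE e tofrac0 mul0r.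
have split0 (p : {poly rat}) : p != 0 ->
    exists k p', p'.[0] != 0 /\ tofrac p = tofrac p' * q ^+ k.
  move=> p0; have [k [p' p'0 ->]] := multiplicity_XsubC p 0.
  exists k, p'; split; first by move: p'0; rewrite p0.
  by rewrite tofracM tofracXn subr0.
have [a [n' [n'0 nE]]] := split0 n n0; have [b [d' [d'0 dE]]] := split0 d d0.
have tn := horner0_neq0 n'0; have td := horner0_neq0 d'0.
rewrite xE nE dE invf_div.
have [ab|ba] := leqP b a; [left|right].
  exists (n' * 'X^(a - b)), d'; split=> //; rewrite tofracM tofracXn -/q.
  by rewrite (expf_quotient _ _ q_neq0 ab).
exists (d' * 'X^(b - a)), n'; split=> //; rewrite tofracM tofracXn -/q.
by rewrite (expf_quotient _ _ q_neq0 (ltnW ba)).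
Qed.

(** * The crystal structure *)

Section CrystalBasis.
Variables (t : affine_type) (r : node t) (V : vectType Qq) (M : Uq_action t V).
Variables (L : V -> Prop) (B : crystal t) (rep : B -> V).
Hypotheses (tv : valid_type t) (r_special : special r) (r0 : r != ord0).
Hypotheses (VKR : KR_module r M) (LB : crystal_basis M L rep).

Let MU : Uq_module M. Proof. by case: VKR. Qed.
Let satM : saturated r (is_weight M).
Proof. by case: VKR => U _ _; apply: KR_saturated. Qed.

Lemma lattice_linear a v w : regular0 a -> L v -> L w -> L (a *: v + w).
Proof.
case: LB => -[[X XB LX] _ _] _ _ _ _ ra /LX lv /LX lw; apply/LX => i.
rewrite linearP; apply: regular0D (lw i); exact: regular0M (lv i).
Qed.

Lemma lattice0 : L 0.
Proof.
by case: LB => -[[X _ LX] _ _] _ _ _ _; apply/LX => i; rewrite linear0; apply: regular0_0.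
Qed.

Lemma latticeZ a v : regular0 a -> L v -> L (a *: v).
Proof.
move=> ra lv; rewrite -[_ *: _]addr0.
by apply: lattice_linear => //; apply: lattice0.
Qed.

Lemma latticeN v : L v -> L (- v).
Proof. by rewrite -scaleN1r; apply: latticeZ; apply: regular0_opp1. Qed.

Lemma lattice_sum (J : eqType) (s : seq J) (P : pred J) (F : J -> V) :
  {in s, forall x, L (F x)} -> L (\sum_(x <- s | P x) F x).
Proof.
move=> LF; rewrite big_seq_cond; apply: (big_ind L) => [|v w lv lw|x /andP[/LF]//].
  exact: lattice0.
rewrite -[v]scale1r; apply: lattice_linear => //.
by rewrite -[1]tofrac1; apply: regular0_tofrac.
Qed.

Let repL b : L (rep b). Proof. by case: LB => _ /(_ b)[]. Qed.
Let rep_wt (b : B) : in_wt M (cwt b) (rep b). Proof. by case: LB => _ /(_ b)[]. Qed.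

Lemma rep_coord v c c' : L v ->
  eq_modq L v (\sum_b qcst (c b) *: rep b) ->
  eq_modq L v (\sum_b qcst (c' b) *: rep b) -> c =1 c'.
Proof.
case: LB => _ _ uniq _ _ /uniq[c0 [_ h]] e e' b.
have -> : c b = c0 b.
  by rewrite (h [ffun b => c b]) ?ffunE //; under eq_bigr do rewrite ffunE.
by rewrite (h [ffun b => c' b]) ?ffunE //; under eq_bigr do rewrite ffunE.
Qed.

Lemma qcst0 : qcst 0 = 0.
Proof. by rewrite /qcst polyC0 tofrac0. Qed.

Lemma qcst1 : qcst 1 = 1.
Proof. by rewrite /qcst polyC1 tofrac1. Qed.

Lemma rep_sum1 a b : \sum_x qcst ((x == b)%:R * a) *: rep x = qcst a *: rep b.
Proof.
rewrite (bigD1 b) //= eqxx mul1r big1 ?addr0 // => x /negbTE->.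
by rewrite mul0r qcst0 scale0r.
Qed.

Lemma eq_modq_refl v : eq_modq L v v.
Proof. by rewrite /eq_modq subrr scaler0; apply: lattice0. Qed.

Lemma eq_modq_rep v a b a' b' : L v -> eq_modq L v (qcst a *: rep b) ->
  eq_modq L v (qcst a' *: rep b') ->
  forall x, (x == b)%:R * a = (x == b')%:R * a'.
Proof. by rewrite -!rep_sum1 => lv e e'; apply: rep_coord lv e e'. Qed.

(** Otherwise 0 would have two expansions in the basis of L / qL. *)
Lemma rep_neq0_modq b : ~ L (q^-1 *: rep b).
Proof.
move=> h; have := @eq_modq_rep 0 0 b 1 b lattice0.
rewrite qcst0 scale0r qcst1 scale1r => /(_ (eq_modq_refl _)).
rewrite /eq_modq sub0r scalerN => /(_ (latticeN h) b)/eqP.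
by rewrite eqxx mulr0 mulr1 eq_sym oner_eq0.
Qed.

Lemma rep_is_weight (b : B) : is_weight M (cwt b).
Proof.
exists (rep b) => //; apply/negP => /eqP e.
by have := @rep_neq0_modq b; rewrite e scaler0; apply; apply: lattice0.
Qed.

Lemma cwt_minuscule (b : B) i : -1 <= cwt b i <= 1.
Proof. exact: (sat_minuscule tv r_special r0 satM) (rep_is_weight b). Qed.

Lemma in_wt_eq0 mu v i : in_wt M mu v -> (1 < mu i) || (mu i < -1) -> v = 0.
Proof.
move=> wv mui; apply/eqP/negPn/negP => v0.
have := sat_minuscule tv r_special r0 satM i (ex_intro2 _ _ v v0 wv).
by move: mui; lia.
Qed.

Lemma alphaii (i : node t) : (alpha i) i = 2.
Proof. by rewrite ffunE cartanii. Qed.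

Lemma divpow0 X (i : node t) (v : V) : divpow X i 0 v = v.
Proof. by rewrite /divpow /qfact big_geq // invr1 scale1r. Qed.

Lemma divpow1 X (i : node t) (v : V) : divpow X i 1 v = X i v.
Proof.
have h := subV_neq0 (q_i_neq0 i) (@q_i_free t i).
by rewrite /divpow /qfact big_nat1 /qint expr1 divff // invr1 scale1r.
Qed.

Lemma divpow_0 X (i : node t) k : divpow X i k (0 : V) = 0.
Proof.
rewrite /divpow (_ : iter k (X i) 0 = 0) ?scaler0 //.
by elim: k => //= k ->; rewrite linear0.
Qed.

(** The string decomposition whose only term is v. Together with [kash_bottom], where v = F (E v),
    it covers all weights that occur, their values lying between -1 and 1. *)
Lemma kash_primitive lam v i : in_wt M lam v -> actE M i v = 0 -> 0 <= lam i ->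
  kash_e M i lam v 0 /\ kash_f M i lam v (actF M i v).
Proof.
move=> wv Ev lami.
have sd : string_dec M i lam v 1 (fun k => if k is 0%N then v else 0).
  split; last by rewrite big_nat1 divpow0.
  - by case=> [|k]; [rewrite mulr0n addr0 | apply: in_wt0].
  - by case=> [|k] //; rewrite linear0.
  - by case=> [|k] //; lia.
split; exists 1%N, (fun k => if k is 0%N then v else 0); split => //.
  by rewrite big_geq.
by rewrite big_nat1 divpow1.
Qed.

Lemma EF_top mu v i : in_wt M mu v -> mu i = 1 ->
  actE M i v = 0 /\ actE M i (actF M i v) = v.
Proof.
move=> wv mui; have Ev : actE M i v = 0.
  by apply: (in_wt_eq0 (i := i) (in_wtE MU i wv)); rewrite ffunE alphaii mui.
split => //; rewrite (EF_wt (q_i_neq0 i) (Uq_sl2 MU i) (wv i)) Ev linear0 add0r.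
by rewrite mui (qbr1 (q_i_neq0 i) (@q_i_free t i)) scale1r.
Qed.

Lemma FE_bottom mu v i : in_wt M mu v -> mu i = -1 ->
  actF M i v = 0 /\ actF M i (actE M i v) = v.
Proof.
move=> wv mui; have Fv : actF M i v = 0.
  apply: (in_wt_eq0 (i := i) (in_wtF MU i wv)).
  by rewrite ffunE [X in _ + X]ffunE alphaii mui.
split => //; have := EF_wt (q_i_neq0 i) (Uq_sl2 MU i) (wv i).
rewrite Fv linear0 mui => /esym/eqP; rewrite addr_eq0 => /eqP->.
rewrite /qbr opprK -opprB mulNr scaleNr opprK.
by rewrite -/(qbr (q_ i) 1) (qbr1 (q_i_neq0 i) (@q_i_free t i)) scale1r.
Qed.

Lemma kash_bottom lam v i : in_wt M lam v -> lam i = -1 ->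
  kash_e M i lam v (actE M i v) /\ kash_f M i lam v 0.
Proof.
move=> wv lami; have [Fv FEv] := FE_bottom wv lami.
have EE : actE M i (actE M i v) = 0.
  apply: (in_wt_eq0 (i := i) (in_wtE MU i (in_wtE MU i wv))).
  by rewrite !ffunE cartanii lami.
pose x k := if k is 1%N then actE M i v else 0.
have sd : string_dec M i lam v 2 x.
  split; last by rewrite big_nat_recl // big_nat1 /= divpow_0 divpow1 FEv add0r.
  - by case=> [|[|k]]; [exact: in_wt0 | exact: in_wtE | exact: in_wt0].
  - by case=> [|[|k]] //=; rewrite linear0.
  - by case=> [|[|k]] //=; rewrite lami.
split; exists 2, x; split => //; first by rewrite big_nat1 divpow0.
rewrite big_nat_recl // big_nat1 /= divpow_0 add0r.
by rewrite /divpow /= FEv Fv scaler0.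
Qed.

Let kashL i lam v w : in_wt M lam v -> L v ->
  (kash_e M i lam v w -> L w) /\ (kash_f M i lam v w -> L w).
Proof. by case: LB => -[_ _ h] _ _ _ _; apply: h. Qed.

Let kashB (i : node t) (b : B) (w : V) :
  (kash_e M i (cwt b) (rep b) w ->
     eq_modq L w (if ce i b is Some b' then rep b' else 0)) /\
  (kash_f M i (cwt b) (rep b) w ->
     eq_modq L w (if cf i b is Some b' then rep b' else 0)).
Proof. by case: LB => _ _ _ h _; apply: h. Qed.

Lemma cf_ce i (b b' : B) : cf i b = Some b' <-> ce i b' = Some b.
Proof. by case: LB => _ _ _ _ h; apply: h. Qed.

Lemma eq_modq0_rep b : ~ eq_modq L 0 (rep b).
Proof.
by rewrite /eq_modq sub0r scalerN => /latticeN; rewrite opprK; apply: rep_neq0_modq.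
Qed.

(** L is graded by weights. If the two weights differed, the component of weight [cwt b] of q^-1 (v
    - rep b) would put q^-1 rep b into L. *)
Lemma eq_modq_wt lam v b : in_wt M lam v -> eq_modq L v (rep b) -> lam = cwt b.
Proof.
move=> wv; rewrite /eq_modq; case: LB => -[_ gr _] _ _ _ _ /gr[s [sP sE]].
apply/eqP/negPn/negP => ne; apply: (@rep_neq0_modq b).
rewrite -[X in L X]opprK; apply: latticeN.
rewrite (@diagonal_component _ _ _ _ (@in_wt_sep t V M) (cwt b)
  ((lam, - (q^-1 *: v)) :: s) (- (q^-1 *: rep b))).
- rewrite big_cons /= (negbTE ne); apply: lattice_sum => x xs.
  by have [] := sP x xs.
- move=> x; rewrite inE => /orP[/eqP->|/sP[]] //=.
  by rewrite -scalerN; apply: in_wtZ; rewrite -scaleN1r; apply: in_wtZ.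
- by rewrite -scaleN1r; do 2 apply: in_wtZ.
- by rewrite big_cons /= -sE scalerBr addKr.
Qed.

(** The value at i is -1, 0 or 1. In the first two cases the lowering operator sends [rep b] to 0,
    which is congruent to no [rep b']; in the last one [eq_modq_wt] gives the weight. *)
Lemma cf_wt i (b b' : B) : cf i b = Some b' ->
  cwt b i = 1 /\ cwt b' = cwt b - alpha i.
Proof.
move=> fb; case: (ltrgtP (cwt b i) 0) (cwt_minuscule b i) => [neg|pos|mi'] mi.
- have mi' : cwt b i = -1 by lia.
  have [_ /(proj2 (kashB i b _))] := kash_bottom (rep_wt b) mi'.
  by rewrite fb => /eq_modq0_rep.
- have mi' : cwt b i = 1 by lia.
  have [Ev _] := EF_top (rep_wt b) mi'.
  have [|_ /(proj2 (kashB i b _))] := kash_primitive (rep_wt b) Ev.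
    by rewrite mi'.
  rewrite fb => /(eq_modq_wt (in_wtF MU i (rep_wt b)))->.
  by split.
- have Ev : actE M i (rep b) = 0.
    apply: (in_wt_eq0 (i := i) (in_wtE MU i (rep_wt b))).
    by rewrite ffunE alphaii mi'.
  have Fv : actF M i (rep b) = 0.
    apply: (in_wt_eq0 (i := i) (in_wtF MU i (rep_wt b))).
    by rewrite ffunE [X in _ + X]ffunE alphaii mi'.
  have [|_ /(proj2 (kashB i b _))] := kash_primitive (rep_wt b) Ev.
    by rewrite mi'.
  by rewrite fb Fv => /eq_modq0_rep.
Qed.

(** If the arrow were missing, q^-1 F (rep b) would lie in L, and the raising operator would bring
    q^-1 rep b into L. *)
Lemma cf_defined i (b : B) : cwt b i = 1 -> exists b', cf i b = Some b'.
Proof.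
move=> mi; case fb: (cf i b) => [b'|]; first by exists b'.
have [Ev EFv] := EF_top (rep_wt b) mi.
have [|_ /(proj2 (kashB i b _))] := kash_primitive (rep_wt b) Ev; first by rewrite mi.
rewrite fb /eq_modq subr0 => h; case: (@rep_neq0_modq b).
have wF := in_wtZ q^-1 (in_wtF MU i (rep_wt b)).
have [|ke _] := kash_bottom wF (i := i).
  by rewrite ffunE [X in _ + X]ffunE alphaii mi.
by have := proj1 (kashL i _ wF h) ke; rewrite linearZ /= EFv.
Qed.

Lemma ce_defined i (b : B) : cwt b i = -1 -> exists b', ce i b = Some b'.
Proof.
move=> mi; case eb: (ce i b) => [b'|]; first by exists b'.
have [Fv FEv] := FE_bottom (rep_wt b) mi.
have [/(proj1 (kashB i b _))] := kash_bottom (rep_wt b) mi.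
rewrite eb /eq_modq subr0 => h _; case: (@rep_neq0_modq b).
have wE := in_wtZ q^-1 (in_wtE MU i (rep_wt b)).
have mE : (cwt b + alpha i) i = 1 by rewrite ffunE alphaii mi.
have [Ev _] := EF_top wE mE.
have [|_ kf] := kash_primitive wE Ev; first by rewrite mE.
by have := proj2 (kashL i _ wE h) kf; rewrite linearZ /= FEv.
Qed.

(** Both representatives span the same line. Their ratio or its inverse is regular at q = 0; its
    residue relates them modulo q, and uniqueness of coordinates gives b = b'. *)
Lemma cwt_varpi_unique (b b' : B) : cwt b = varpi r -> cwt b' = varpi r -> b = b'.
Proof.
case: VKR => _ _ _ [[v0 _ v0P] _] wb wb'.
have [c bE] := v0P (rep b) ltac:(by rewrite -wb; apply: rep_wt).
have [c' b'E] := v0P (rep b') ltac:(by rewrite -wb'; apply: rep_wt).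
have rep0 x : rep x != 0.
  apply/negP => /eqP e; have := @rep_neq0_modq x.
  by rewrite e scaler0; apply; apply: lattice0.
have cn : c != 0 by apply: contraNneq (rep0 b) => e; rewrite bE e scale0r.
have cn' : c' != 0 by apply: contraNneq (rep0 b') => e; rewrite b'E e scale0r.
have residue x y d : rep x = d *: rep y -> regular0 d -> x = y.
  move=> xE /regular0_residue[a ra].
  have := @eq_modq_rep (rep x) 1 x a y (repL x).
  rewrite qcst1 scale1r => /(_ (eq_modq_refl _)).
  rewrite {1}/eq_modq {1}xE -scalerBl scalerA => /(_ (latticeZ ra (repL y)) x).
  rewrite eqxx mul1r; case: eqP => // _ /eqP.
  by rewrite mul0r oner_eq0.
have [rc|rc] := regular0_valuation (c / c').
  apply: (residue _ _ _ _ rc); rewrite b'E bE scalerA mulfVK //.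
apply/esym; apply: (residue _ _ _ _ rc).
by rewrite b'E bE scalerA invf_div mulfVK.
Qed.

End CrystalBasis.

(** * Energy along crystal paths *)

Section Potential.
Variables (t : affine_type) (r : node t).
Hypotheses (tv : valid_type t) (r_special : special r).

(* Pairing with a level zero weight whose value on h_i is 1 for i != r: it
   increases along every f_i with i != r and is unchanged by delta. *)
Definition potential (x : node t -> int) : int :=
  \sum_(i < (rank t).+1) (symm t i)%:Z * x i *
    (if i == r then - \sum_(j | j != r) (comark t j)%:Z else 1).

(** The coefficients in [potential] pair to 0 with the comarks, as [comark t r] is 1; this kills the
    multiple of [delta] left free in [x]. *)
Lemma potential_unique mu x x' : below_varpi r mu x -> below_varpi r mu x' ->
  potential x = potential x'.
Proof.
move=> mux mux'; apply/eqP; rewrite -subr_eq0 -sumrB.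
under eq_bigr do rewrite -mulrBl -mulrBr (below_varpi_unique tv mux mux') -mulrA.
rewrite -mulr_sumr (bigD1 r) //= eqxx special_comark // mul1r.
rewrite [X in _ * (_ + X)](_ : _ = \sum_(j | j != r) (comark t j)%:Z).
  by rewrite addNr mulr0.
by apply: eq_bigr => j /negbTE->; rewrite mulr1.
Qed.

Lemma potential_shift x a : a != r ->
  potential (shift x a (-1)) = potential x + (symm t a)%:Z.
Proof.
move=> ar; rewrite /potential (bigD1 a) //= [in RHS](bigD1 a) //= (negbTE ar).
rewrite /shift eqxx !mulr1 opprK mulrDr mulr1 addrAC; congr (_ + _ + _).
by apply: eq_bigr => i /negbTE->; rewrite mulr0 subr0.
Qed.

End Potential.

Lemma uniform_bound (T : finType) (P : T -> nat -> Prop) :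
  (forall x m n, (m <= n)%N -> P x m -> P x n) -> (forall x, exists n, P x n) ->
  exists n, forall x, P x n.
Proof.
move=> Pmono Pex; suff [n h] : exists n, {in enum T, forall x, P x n}.
  by exists n => x; apply: h; rewrite mem_enum.
elim: (enum T) => [|x s [n IH]]; first by exists 0%N.
have [m Pm] := Pex x; exists (maxn m n) => y; rewrite inE => /orP[/eqP->|ys].
  exact: Pmono (leq_maxl _ _) Pm.
exact: Pmono (leq_maxr _ _) (IH y ys).
Qed.

Lemma iter_obind_None (T : Type) (f : T -> option T) k :
  iter k (obind f) None = None.
Proof. by elim: k => //= k ->. Qed.

Lemma foldl_obind_None (S T : Type) (f : S -> T -> option T) p :
  foldl (fun ox a => obind (f a) ox) None p = None.
Proof. by elim: p. Qed.

Lemma phi_eq0 t (B : crystal t) i (b : B) : cf i b = None -> phi i b = 0%N.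
Proof.
move=> fb; apply/eqP; rewrite -leqn0; apply/bigmax_leqP => -[[|k] kB] //=.
by rewrite -iterS iterSr /= fb iter_obind_None.
Qed.

Lemma eps_gt0 t (B : crystal t) i (b b' : B) : ce i b = Some b' -> (0 < eps i b)%N.
Proof.
move=> eb; have B0 : (1 < #|B|.+1)%N by rewrite ltnS; apply/card_gt0P; exists b.
by apply: (bigop.bigmax_sup (Ordinal B0)) => //=; rewrite eb.
Qed.

(** * Classical paths and the energy along paths avoiding r *)

Section Paths.
Variables (t : affine_type) (r : node t) (V : vectType Qq) (M : Uq_action t V).
Variables (L : V -> Prop) (B : crystal t) (rep : B -> V).
Hypotheses (tv : valid_type t) (r_special : special r) (r0 : r != ord0).
Hypotheses (VKR : KR_module r M) (LB : crystal_basis M L rep).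
Variable (u : B).
Hypothesis u_max : classical_weight r u.

Let satM : saturated r (is_weight M).
Proof. by case: VKR => U _ _; apply: KR_saturated. Qed.

Lemma cwt_u : cwt u = varpi r.
Proof.
apply: (sat_dominant tv r_special r0 satM); first exact: rep_is_weight LB u.
by move=> a a0; rewrite u_max // ffunE.
Qed.

(** Climbing from b by e_a, with a classical and the weight negative at a, lowers the height; it
    stops at a dominant weight, hence at u. *)
Lemma classical_path_from_u b : exists p, classical_path u b p.
Proof.
have [c [c0 bc]] := sat_height satM (rep_is_weight LB b).
have [n] := ubnP (\sum_i c i)%N; elim: n b c c0 bc => // n IH b c c0 bc cn.
have [/existsP[a /andP[a0 ba]]|] := boolP [exists a, (a != ord0) && (cwt b a < 0)].
  have ba1 : cwt b a = -1.
    by have := cwt_minuscule tv r_special r0 VKR LB b a; lia.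
  have [b' eb] := ce_defined tv r_special r0 VKR LB ba1.
  have fb' : cf a b' = Some b by apply/(cf_ce LB).
  have [_ bE] := cf_wt tv r_special r0 VKR LB fb'.
  have b'E : cwt b' = cwt b + alpha a *~ 1 by rewrite bE subrK.
  have := rep_is_weight LB b'; rewrite b'E => Wb'.
  have [c' [c'0 bc' cc']] :=
    sat_height_shift tv r_special r0 satM c0 bc a0 (ltr01 : 0 < 1 :> int) Wb'.
  rewrite -b'E in bc'; have [p [p0 pE]] := IH b' c' c'0 bc' (leq_trans cc' cn).
  (* The climb starts at b while the path ends there, so the first arrow climbed comes last. *)
  exists (rcons p a); split.
    by rewrite mem_rcons inE negb_or eq_sym a0.
  by rewrite foldl_rcons pE.
rewrite negb_exists => /forallP h.
have bv : cwt b = varpi r.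
  apply: (sat_dominant tv r_special r0 satM); first exact: rep_is_weight LB b.
  by move=> a a0; have := h a; rewrite a0 /= -leNgt.
rewrite (cwt_varpi_unique VKR LB bv cwt_u).
by exists [::].
Qed.

Lemma classical_path_wt b p : classical_path u b p ->
  below_varpi r (cwt b) (fun i => (count_mem i p)%:Z).
Proof.
move=> [_]; have := @below_varpi_varpi t r; rewrite -cwt_u.
suff gen b0 x : below_varpi r (cwt b0) x ->
    foldl (fun ob a => obind (cf a) ob) (Some b0) p = Some b ->
    below_varpi r (cwt b) (fun i => x i + (count_mem i p)%:Z).
  by move=> /gen h /h bx i; rewrite bx; congr (_ - _).
elim: p b0 x => [|a p IH] b0 x b0x /=.
  by move=> [<-] i; rewrite b0x; congr (_ - _); apply: eq_bigr => j _; rewrite addr0.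
case fb: (cf a b0) => [b1|]; last by rewrite foldl_obind_None.
have [_ b1E] := cf_wt tv r_special r0 VKR LB fb.
have := below_varpi_shift a (-1) b0x; rewrite mulrN1z -b1E => /IH h /h bx i.
rewrite bx; congr (_ - _); apply: eq_bigr => j _; congr (_ * _).
by rewrite /shift mulN1r opprK PoszD addrA [a == j]eq_sym; case: eqP.
Qed.

Variable H : B * B -> int.
Hypothesis H_energy : local_energy u H.

(* For a != r, phi_a u = 0, so that e_a acts on the left factor of b' (x) u. *)
Lemma tensor_e_left a (b b' : B) : a != r -> cf a b = Some b' ->
  e_left a (b', u) /\ tensor_e a (b', u) = Some (b, u).
Proof.
move=> ar fb; have eb : ce a b' = Some b by apply/(cf_ce LB).
suff el : e_left a (b', u) by rewrite /tensor_e el /= eb.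
rewrite /e_left /= phi_eq0 ?(eps_gt0 eb) //.
case fu: (cf a u) => [u'|] //.
have [] := cf_wt tv r_special r0 VKR LB fu.
rewrite cwt_u varpiE // (negbTE ar); case: eqP => //.
Qed.

(** Here [n] counts by colour the arrows of a path from b to u that avoids r. A step f_a from b to
    b' is undone by e_a on the left factor of the pair (b', u), which adds 1 to [H] exactly when a =
    0. The last clause records the weight of the path, whichever [x] represents [cwt b]. *)
Lemma energy_descent b : exists n : node t -> nat,
  [/\ n r = 0%N, H (b, u) = (n ord0)%:Z &
   forall x, below_varpi r (cwt b) x ->
     below_varpi r (varpi r) (fun i => x i + (n i)%:Z)].
Proof.
(* The potential depends only on the weight and B is finite, so it is bounded; each step raises it,
   hence the path terminates. *)
have [N Nbound] : exists N, forall b x, below_varpi r (@cwt t B b) x ->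
    potential r x <= N%:Z.
  apply: uniform_bound => [b' m n mn h x /h|b']; first by lia.
  have [c [_ bc]] := sat_height satM (rep_is_weight LB b').
  exists (absz (potential r (fun i => (c i)%:Z))) => x bx.
  by rewrite (potential_unique tv r_special bx bc); lia.
have [c [_ bc]] := sat_height satM (rep_is_weight LB b).
have [m] := ubnP (absz (N%:Z - potential r (fun i => (c i)%:Z))).
move: {c} (fun i => (c i)%:Z) bc => c bc; elim: m b c bc => // m IH b c bc cm.
have [/existsP[a /andP[ar ba]]|] := boolP [exists a, (a != r) && (0 < cwt b a)].
  have ba1 : cwt b a = 1.
    by have := cwt_minuscule tv r_special r0 VKR LB b a; lia.
  have [b' fb] := cf_defined tv r_special r0 VKR LB ba1.
  have [_ b'E] := cf_wt tv r_special r0 VKR LB fb.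
  have sh x : below_varpi r (cwt b) x -> below_varpi r (cwt b') (shift x a (-1)).
    by move=> bx; have := below_varpi_shift a (-1) bx; rewrite mulrN1z -b'E.
  have [|n [nr Hn nb]] := IH b' _ (sh c bc).
    have := Nbound b' _ (sh c bc); rewrite potential_shift //.
    by have := symm_gt0 t a; lia.
  exists (fun i => n i + (i == a))%N; split.
  - by rewrite nr eq_sym (negbTE ar).
  - have [el te] := tensor_e_left ar fb.
    rewrite (H_energy.2 _ _ _ te) el Hn eq_sym PoszD.
    by case: eqP.
  - move=> x /sh/nb bx i; rewrite [LHS]bx; congr (_ - _).
    apply: eq_bigr => j _; congr (_ * _).
    by rewrite /shift mulN1r opprK PoszD -!addrA [X in _ + X]addrC.
rewrite negb_exists => /forallP h.
have bv : cwt b = varpi r.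
  apply: (sat_antidominant tv r_special r0 satM); first exact: rep_is_weight LB b.
  by move=> a ar; have := h a; rewrite ar /= -leNgt.
rewrite (cwt_varpi_unique VKR LB bv cwt_u).
exists (fun=> 0%N); split => //; first by have [-> _] := H_energy.
rewrite cwt_u => x bx i; rewrite [LHS]bx; congr (_ - _).
by apply: eq_bigr => j _; rewrite addr0.
Qed.

(** The path [p] followed by the one of [energy_descent] is closed, so its colour counts form a
    multiple of [delta], with equal coefficients at r and 0. The first path has no 0-arrow and the
    second no r-arrow. *)
Lemma energy_classical_path b p : classical_path u b p ->
  H (b, u) = (count_mem r p)%:Z.
Proof.
move=> up; have [n [nr -> nb]] := energy_descent b.
have := below_varpi_unique tv (nb _ (classical_path_wt up))
  (@below_varpi_varpi t r) r.
have cr := special_comark tv r_special.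
rewrite !subr0 nr cr (symm_comark1 tv (leq_ord r) cr).
have [p0 _] := up; rewrite (count_memPn p0).
by lia.
Qed.

End Paths.

Theorem theorem3p6 (t : affine_type) (t_valid : valid_type t)
    (r : node t) (r_classical : r != ord0) (r_special : special r)
    (B : crystal t) (B_KR : KR_crystal r B)
    (u : B) (u_max : classical_weight r u)
    (H : B * B -> int) (H_energy : local_energy u H)
    (b : B) (bu_highest : classically_highest (b, u)) :
  (exists p : seq (node t), classical_path u b p) /\
  (forall p : seq (node t), classical_path u b p ->
     H (b, u) = (count_mem r p)%:Z).
Proof.
have [V [M [L [rep [VKR LB]]]]] := B_KR; split.
  exact: (classical_path_from_u t_valid r_special r_classical VKR LB u_max).
move=> p.
exact: (energy_classical_path t_valid r_special r_classical VKR LB u_max H_energy).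
Qed.
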